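(* Let $B=(B_t)_{t\ge 0}$ be a standard Brownian motion defined on a probability space $(\Omega,\mathcal F,\mathsf P)$ with $B_0=0$, and let $\mu$ be a probability measure on $(\mathbb R,\mathcal B(\mathbb R))$ such that $\mu(\{0\})=0$. (I) If $\operatorname{supp}(\mu)\subseteq\mathbb R_+$, then there exists a left-continuous increasing function $b:(0,\infty)\to\mathbb R$ such that $B_{\tau_b}\sim\mu$, where $\tau_b=\inf\{t>0 : B_t\ge b(t)\}$. (II) If $\operatorname{supp}(\mu)\subseteq\mathbb R_-$, then there exists a left-continuous decreasing function $c:(0,\infty)\to\mathbb R$ such that $B_{\tau_c}\sim\mu$, where $\tau_c=\inf\{t>0 : B_t\le c(t)\}$. (III) If $\operatorname{supp}(\mu)\cap\mathbb R_+\ne\varnothing$ and $\operatorname{supp}(\mu)\cap\mathbb R_-\ne\varnothing$, then there exist a left-continuous increasing function $b:(0,\infty)\to\mathbb R\cup\{+\infty\}$ and a left-continuous decreasing function $c:(0,\infty)\to\mathbb R\cup\{-\infty\}$ such that $B_{\tau_{b,c}}\sim\mu$, where $\tau_{b,c}=\inf\{t>0 : B_t\ge b(t)\text{ or }B_t\le c(t)\}$.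
   Context: $\mathbb R_+=[0,\infty)$ and $\mathbb R_-=(-\infty,0]$. $\operatorname{supp}(\mu)$ is the (closed) topological support of $\mu$. ''Increasing'' and ''decreasing'' are meant in the weak sense (non-decreasing, non-increasing). For a random time $\tau$, $B_\tau\sim\mu$ means that $\tau<\infty$ $\mathsf P$-almost surely and the law of $B_\tau$ under $\mathsf P$ is $\mu$. *)

(* Defs.v *)
From HB Require Import structures.
From mathcomp Require Export all_boot all_order all_algebra.
From mathcomp Require Export all_classical all_reals all_analysis.

Set Implicit Arguments.
Unset Strict Implicit.
Unset Printing Implicit Defensive.

Export Order.TTheory GRing.Theory Num.Theory.
Export numFieldNormedType.Exports.

Local Open Scope classical_set_scope.
Local Open Scope ring_scope.

(* Requiring the product rule only for the full family is enough: taking some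
   of the [A i] to be [setT] gives it for every subfamily. *)
Definition mutually_independent (d : measure_display) (T : measurableType d)
    (R : realType) (P : probability T R) (n : nat) (X : 'I_n -> T -> R) : Prop :=
  forall A : 'I_n -> set R, (forall i, measurable (A i)) ->
    P (\bigcap_(i in [set: 'I_n]) X i @^-1` A i) =
    (\prod_(i < n) P (X i @^-1` A i))%E.

(* The process is indexed by all of [R] for convenience; only the times
   [t >= 0] are constrained, and [B t] for [t < 0] plays no role. The second
   argument of [normal_prob] is the standard deviation. *)
Record standard_brownian_motion (d : measure_display) (T : measurableType d)
    (R : realType) (P : probability T R) (B : R -> {RV P >-> R}) : Prop := {
  bm_start : {ae P, forall w, B 0 w = 0} ;
  bm_continuous :
    {ae P, forall w, {within `[0, +oo[, continuous (fun t => B t w)}} ;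
  bm_independent : forall (n : nat) (t : nat -> R),
    0 <= t 0%N -> (forall i, (i < n)%N -> t i <= t i.+1) ->
    mutually_independent P (fun (i : 'I_n) w => B (t i.+1) w - B (t i) w) ;
  bm_normal : forall s t, 0 <= s -> s < t ->
    forall A : set R, measurable A ->
      P [set w | A (B t w - B s w)] = normal_prob 0 (Num.sqrt (t - s)) A
}.

Definition topological_support (R : realType)
    (mu : probability (measurableTypeR R) R) : set R :=
  [set x | forall U : set R, open U -> U x -> (0 < mu U)%E].

(* [inf {t > 0 : E t w}], with [inf set0 = +oo]. *)
Definition first_time (T : Type) (R : realType) (E : R -> T -> Prop) (w : T) :
    \bar R :=
  ereal_inf [set t%:E | t in [set t : R | 0 < t /\ E t w]].

(* [B_tau] is defined only where [tau < +oo]; its law is that of any random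
   variable [X] that is almost surely equal to it. *)
Definition stopped_law (d : measure_display) (T : measurableType d)
    (R : realType) (P : probability T R) (B : R -> T -> R) (tau : T -> \bar R)
    (mu : probability (measurableTypeR R) R) : Prop :=
  {ae P, forall w, (tau w < +oo)%E} /\
  exists X : {RV P >-> R},
    {ae P, forall w, B (fine (tau w)) w = X w} /\
    forall A : set R, measurable A -> distribution P X A = mu A.

Definition left_continuous_on_pos (R : realType) (V : topologicalType)
    (f : R -> V) : Prop :=
  forall t : R, 0 < t -> f s @[s --> t^'-] --> f t.

Definition increasing_on_pos (R : realType) (disp : Order.disp_t)
    (V : porderType disp) (f : R -> V) : Prop :=
  forall s t : R, 0 < s -> s <= t -> (f s <= f t)%O.

Definition decreasing_on_pos (R : realType) (disp : Order.disp_t)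
    (V : porderType disp) (f : R -> V) : Prop :=
  forall s t : R, 0 < s -> s <= t -> (f t <= f s)%O.

(* Main.v *)
From HB Require Import structures.
Require Import Defs.
From mathcomp Require Import measurable_realfun.
From mathcomp Require Import ring lra zify.

Set Implicit Arguments.
Unset Strict Implicit.
Unset Printing Implicit Defensive.

Local Open Scope classical_set_scope.
Local Open Scope ring_scope.

(** The barriers are reversed (Rost) barriers: the region where the path is
   stopped contains, with a point, all earlier points at the same height. This is
   what the monotonicity of [b] and [c] expresses, and it makes stopping at one
   level compete monotonically with stopping at the others.

   For a law with finitely many atoms, every level [x i] is kept active up to a
   cutoff time. Raising the cutoff of one level can only decrease, path by path,
   the mass stopped at the other levels. Hence the coordinatewise supremum of all
   vectors of cutoffs that put at most the prescribed mass on every level still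
   has this property. If some level received too little mass there, its cutoff
   could be raised a little more, because passage times have no atoms; and if the
   cutoff is infinite, then every path is stopped, so that the masses have the
   right sum ([cutoffs_exist], [discrete_embedding]).

   A general law [mu] is a limit of images of [mu] under simple maps that avoid
   [0]. Helly selection ([ereal_diagonal]) extracts a left-continuous limit of the
   barriers, and two facts make the hitting times converge. A limit of hitting
   points is a hitting point of the limit barrier ([limit_touch]). Conversely, a
   path that touches an increasing barrier crosses it strictly at once
   ([touch_then_cross]), and a strict crossing is also a crossing of the
   approximating barriers. The second fact holds because the supremum of
   [W - b] over a time interval starting at [a > 0] is the sum of [W a] and of an
   independent variable, so that it has no atom at [0] ([sup_dyadic_gap]).
   Stopping close to time [0] is excluded by [mu [set 0] = 0] ([tau_not_small]),
   stopping very late by recurrence or by the tails of [mu] ([sigma_lty]); the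
   stopped values therefore converge in law ([limit_law_le]).

   If [mu] lives on one side of [0], then the sign of the stopped value shows that
   the other barrier is never the one that is hit. The remaining barrier is finite:
   otherwise it would be infinite from some time on, all paths would have been
   stopped by then, whereas a Brownian path stays below an increasing barrier for
   any given time with positive probability ([stay_below_barrier], from Lévy's
   maximal inequality). *)

(** * Real-valued probabilities *)

Lemma if_measurable d (T : measurableType d) (b : bool) (A B : set T) :
  measurable A -> measurable B -> measurable (if b then A else B).
Proof. by case: b. Qed.

Section real_probability.
Context d (T : measurableType d) (R : realType) (P : probability T R).
Implicit Types A B : set T.

Definition Pr A : R := fine (P A).

Lemma prE A : measurable A -> P A = (Pr A)%:E.
Proof. by move=> mA; rewrite fineK// fin_num_measure. Qed.

Lemma pr_ge0 A : 0 <= Pr A.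
Proof. by rewrite fine_ge0. Qed.

Lemma pr_le1 A : measurable A -> Pr A <= 1.
Proof. by move=> mA; rewrite -lee_fin -prE// probability_le1. Qed.

Lemma prT : Pr setT = 1.
Proof. by rewrite /Pr probability_setT. Qed.

Lemma pr0 : Pr set0 = 0.
Proof. by rewrite /Pr measure0. Qed.

Lemma le_pr A B : measurable A -> measurable B -> A `<=` B -> Pr A <= Pr B.
Proof.
by move=> mA mB AB; rewrite -lee_fin -!prE//; apply: le_measure; rewrite ?inE.
Qed.

Lemma pr_setC A : measurable A -> Pr (~` A) = 1 - Pr A.
Proof.
move=> mA; apply: EFin_inj; rewrite EFinB -!prE//; last exact: measurableC.
exact: probability_setC.
Qed.

Lemma pr_setU_disj A B : measurable A -> measurable B -> A `&` B = set0 ->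
  Pr (A `|` B) = Pr A + Pr B.
Proof.
move=> mA mB AB; apply: EFin_inj; rewrite EFinD -!prE//; last exact: measurableU.
by rewrite measureU.
Qed.

Lemma pr_setID A B : measurable A -> measurable B ->
  Pr A = Pr (A `&` B) + Pr (A `\` B).
Proof.
move=> mA mB; rewrite -pr_setU_disj ?setUIDK//.
- exact: measurableI.
- exact: measurableD.
- by rewrite setDE setIACA setICr setI0.
Qed.

Lemma pr_setU_le A B : measurable A -> measurable B ->
  Pr (A `|` B) <= Pr A + Pr B.
Proof.
move=> mA mB; have -> : A `|` B = A `|` (B `\` A) by rewrite setUDr setDv setD0.
have mD : measurable (B `\` A) by exact: measurableD.
rewrite pr_setU_disj//; last by rewrite setDE setICA setICr setI0.
by rewrite lerD2l; apply: le_pr => // x [].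
Qed.

Lemma pr_bigcup_le (I : Type) (s : seq I) (F : I -> set T) :
  (forall i, measurable (F i)) ->
  Pr (\big[setU/set0]_(i <- s) F i) <= \sum_(i <- s) Pr (F i).
Proof.
move=> mF; elim: s => [|i s IH]; first by rewrite !big_nil pr0.
rewrite !big_cons (le_trans (pr_setU_le _ _))//.
  exact: bigsetU_measurable.
by rewrite lerD2l.
Qed.

Lemma pr_nondecreasing (F : nat -> set T) : (forall n, measurable (F n)) ->
  (forall n, F n `<=` F n.+1) -> forall e, 0 < e ->
  exists N, forall n, (N <= n)%N -> Pr (\bigcup_n F n) - e < Pr (F n).
Proof.
move=> mF ndF e e0.
have mU : measurable (\bigcup_n F n) by exact: bigcup_measurable.
have nd : nondecreasing_seq F.
  by apply/nondecreasing_seqP => n; apply/subsetPset.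
have : P (F n) @[n --> \oo] --> P (\bigcup_n F n).
  exact: nondecreasing_cvg_mu mF mU nd.
rewrite prE// => /fine_cvgP[_ /cvgrPdist_lt/(_ _ e0)[N _ HN]].
exists N => n /HN /=; rewrite -/(Pr (F n)) ltr_distl => /andP[]; lra.
Qed.

Lemma pr_nonincreasing (F : nat -> set T) : (forall n, measurable (F n)) ->
  (forall n, F n.+1 `<=` F n) -> forall e, 0 < e ->
  exists N, forall n, (N <= n)%N -> Pr (F n) < Pr (\bigcap_n F n) + e.
Proof.
move=> mF niF e e0.
have [|n sF|N HN] := @pr_nondecreasing (fun n => ~` F n) _ _ e e0.
- by move=> n; exact: measurableC.
- exact: subsetC.
exists N => n /HN; rewrite -setC_bigcap !pr_setC//; first lra.
exact: bigcap_measurable.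
Qed.

Lemma pr_cvg_nondecreasing (F : nat -> set T) : (forall n, measurable (F n)) ->
  (forall n, F n `<=` F n.+1) -> Pr (F n) @[n --> \oo] --> Pr (\bigcup_n F n).
Proof.
move=> mF ndF; apply/cvgrPdist_lt => e e0.
have [N HN] := pr_nondecreasing mF ndF e0.
have mU : measurable (\bigcup_n F n) by exact: bigcup_measurable.
exists N => // n /= /HN; have : Pr (F n) <= Pr (\bigcup_n F n).
  by apply: le_pr => // x Fx; exists n.
by move=> h1 h2; rewrite ger0_norm; lra.
Qed.

Lemma le_pr_ae A B : measurable A -> measurable B ->
  {ae P, forall w, A w -> B w} -> Pr A <= Pr B.
Proof.
move=> mA mB [N [mN N0 AB]]; have pN : Pr N = 0 by rewrite /Pr N0.
rewrite (le_trans (_ : _ <= Pr (B `|` N)))//.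
  apply: le_pr => //; first exact: measurableU.
  by move=> x Ax /=; apply: contrapT => /not_orP[nB nN]; apply/nN/AB => /(_ Ax).
by rewrite (le_trans (pr_setU_le _ _))// pN addr0.
Qed.

Lemma eq_pr_ae A B : measurable A -> measurable B ->
  {ae P, forall w, A w <-> B w} -> Pr A = Pr B.
Proof.
move=> mA mB AB; apply/eqP; rewrite eq_le !le_pr_ae//.
- by apply: filterS AB => w [].
- by apply: filterS AB => w [].
Qed.

(** Fatou's lemma for indicators. The error term makes it easy to combine with
   other estimates that hold from some rank on. *)
Lemma pr_liminf (E : set T) (F : nat -> set T) : measurable E ->
  (forall n, measurable (F n)) ->
  {ae P, forall w, E w -> exists N, forall n, (N <= n)%N -> F n w} ->
  forall e, 0 < e ->
  exists N, forall n, (N <= n)%N -> Pr E < Pr (F n) + e.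
Proof.
move=> mE mF EF e e0.
pose G n := \bigcap_(k in [set k | (n <= k)%N]) F k.
have mG n : measurable (G n).
  by apply: bigcap_measurableType => k _.
have [n x Gx k /= nk|N HN] := @pr_nondecreasing G mG _ e e0.
  by apply: Gx => /=; exact: ltnW.
exists N => n Nn.
have EG : Pr E <= Pr (\bigcup_n G n).
  apply: le_pr_ae => //; first exact: bigcup_measurable.
  by apply: filterS EF => w + Ew => /(_ Ew)[M HM]; exists M => // k /HM.
have GF : Pr (G n) <= Pr (F n) by apply: le_pr => // w; apply => /=.
by have := HN _ Nn; lra.
Qed.

Lemma ae_prP (A : set T) : measurable A -> Pr A = 1 <-> {ae P, forall w, A w}.
Proof.
move=> mA; split=> [A1|AE].
  exists (~` A); split => //; first exact: measurableC.
  by rewrite prE ?pr_setC ?A1 ?subrr//; exact: measurableC.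
by rewrite -prT; apply: eq_pr_ae => //; apply: filterS AE => w.
Qed.

Lemma ae_pr0P (A : set T) : measurable A -> Pr A = 0 <-> {ae P, forall w, ~ A w}.
Proof.
move=> mA; have -> : Pr A = 0 <-> Pr (~` A) = 1.
  by rewrite pr_setC//; split=> [->|]; lra.
exact/ae_prP/measurableC.
Qed.

End real_probability.

(** * Estimates for the normal law *)

Section normal_bounds.
Context (R : realType).
Implicit Types (s a b c : R).
Local Notation mu := (@lebesgue_measure R).
Local Notation N s := (@normal_prob R 0 s).

Let mpdf s (A : set R) :
  measurable_fun A (fun x => (normal_pdf 0 s x)%:E).
Proof.
apply/measurable_EFinP; apply: measurable_funTS.
exact: measurable_normal_pdf.
Qed.

Let mu_itv a b : a <= b -> mu `]a, b] = (b - a)%:E.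
Proof.
by rewrite lebesgue_measure_itv/= lte_fin le_eqVlt => /predU1P[->|->//]; rewrite ltxx subrr.
Qed.

Lemma normal_prob_le s a b : s != 0 -> a <= b ->
  (N s `]a, b]%classic <= (normal_peak s * (b - a))%:E)%E.
Proof.
move=> s0 ab; rewrite /normal_prob EFinM -mu_itv// -integral_cst//.
apply: ge0_le_integral => //.
- by move=> x _; rewrite lee_fin normal_pdf_ge0.
exact: mpdf.
by move=> x _; rewrite lee_fin normal_pdf_ub.
Qed.

Lemma normal_prob_ge s a b c : a <= b -> 0 <= c ->
  (forall x, a <= x <= b -> c <= normal_pdf 0 s x) ->
  ((c * (b - a))%:E <= N s `]a, b]%classic)%E.
Proof.
move=> ab c0 cpdf; rewrite /normal_prob EFinM -mu_itv// -integral_cst//.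
apply: ge0_le_integral => //; first exact: mpdf.
move=> x; rewrite /= in_itv/= => /andP[ax xb]; rewrite lee_fin; apply: cpdf.
by rewrite xb ltW.
Qed.

Lemma normal_pdf_opp s x : s != 0 -> normal_pdf 0 s (- x) = normal_pdf 0 s x.
Proof.
by move=> s0; rewrite !normal_pdfE// /normal_fun !subr0 sqrrN.
Qed.

Lemma normal_prob_opp s (A : set R) : s != 0 -> measurable A ->
  N s (-%R @^-1` A) = N s A.
Proof.
move=> s0 mA; rewrite /normal_prob.
under eq_integral do rewrite -normal_pdf_opp//.
rewrite -(@ge0_integral_pushforward _ _ (measurableTypeR R) (measurableTypeR R) R
   -%R _ mu A (fun x => (normal_pdf 0 s x)%:E))//=; last first.
  by move=> x _; rewrite lee_fin normal_pdf_ge0.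
exact: mpdf.
by apply: eq_measure_integral => //= B mB BA; exact/lebesgue_measureN.
Qed.

(** By scale invariance the bound is uniform in [s]: on [`]s, 2 s]] the density is
   at least [expR (-2)] times its peak, and the peak is proportional to [1 / s]. *)
Lemma normal_prob_gt_sigma :
  exists2 p : R, 0 < p & forall s, 0 < s -> (p%:E <= N s `]s, +oo[%classic)%E.
Proof.
exists ((Num.sqrt (pi *+ 2))^-1 * expR (- 2)).
  by rewrite mulr_gt0 ?expR_gt0// invr_gt0 sqrtr_gt0 pmulrn_lgt0// pi_gt0.
move=> s s0.
have -> : (Num.sqrt (pi *+ 2))^-1 * expR (- 2) =
    (normal_peak s * expR (-2)) * (2 * s - s) :> R.
  rewrite /normal_peak -mulrnAr sqrtrM ?sqr_ge0// sqrtr_sqr gtr0_norm//.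
  have : Num.sqrt (pi *+ 2) != 0 :> R.
    by rewrite gt_eqF// sqrtr_gt0 pmulrn_lgt0// pi_gt0.
  by move=> ?; field; lra.
apply: le_trans (normal_prob_ge (s := s) (c := normal_peak s * expR (-2)) _ _ _) _.
- lra.
- by rewrite mulr_ge0 ?expR_ge0 ?normal_peak_ge0.
- move=> x /andP[sx x2s]; rewrite normal_pdfE ?gt_eqF// ler_wpM2l ?normal_peak_ge0//.
  rewrite /normal_fun subr0 ler_expR mulNr lerNl opprK ler_pdivrMr.
    rewrite -mulr_natr; nra.
  by rewrite pmulrn_lgt0// exprn_gt0.
- by apply: le_measure; rewrite ?inE// => x; rewrite /= !in_itv/= andbT => /andP[].
Qed.

End normal_bounds.

(** * Independence of blocks of independent variables *)

Section independence.
Context d (T : measurableType d) (R : realType) (P : probability T R).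
Local Notation pr := (Pr P).

(** For a fixed [A], the events independent of [A] form a lambda-system. *)
Lemma indep_sigma_r (A : set T) (G : set (set T)) : measurable A ->
  setI_closed G -> G `<=` measurable ->
  (forall B, G B -> pr (A `&` B) = pr A * pr B) ->
  forall B, <<s G >> B -> pr (A `&` B) = pr A * pr B.
Proof.
move=> mA GI Gm AG.
pose H := [set B : set T | measurable B /\ pr (A `&` B) = pr A * pr B].
suff : <<s G >> `<=` H by move=> GH B /GH[].
apply: (lambda_system_subset GI) => //; last first.
  by move=> B GB; split; [exact: Gm|exact: AG].
split => //.
- by split => //; rewrite setIT prT mulr1.
- move=> B C CB [mB HB] [mC HC]; split; first exact: measurableD.
  have := pr_setID P mB mC; rewrite setIidr// => eB.
  have := pr_setID P (measurableI _ _ mA mB) mC.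
  rewrite -setIA (setIidr CB) -setIDA HB HC eB; lra.
- move=> F ndF HF.
  have ndF' n : F n `<=` F n.+1 by exact/subsetPset/ndF.
  have mF n : measurable (F n) by have [] := HF n.
  split; first exact: bigcup_measurable.
  rewrite setI_bigcupr.
  have c1 : pr (A `&` F n) @[n --> \oo] --> pr (\bigcup_n (A `&` F n)).
    apply: pr_cvg_nondecreasing => n; first exact: measurableI.
    exact: setIS.
  have c2 : pr (A `&` F n) @[n --> \oo] --> pr A * pr (\bigcup_n F n).
    under eq_fun do rewrite (HF _).2.
    by apply: cvgMr; exact: pr_cvg_nondecreasing.
  exact: cvg_unique c1 c2.
Qed.

Lemma indep_sigma (G1 G2 : set (set T)) :
  setI_closed G1 -> G1 `<=` measurable -> setI_closed G2 -> G2 `<=` measurable ->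
  (forall A B, G1 A -> G2 B -> pr (A `&` B) = pr A * pr B) ->
  forall A B, <<s G1 >> A -> <<s G2 >> B -> pr (A `&` B) = pr A * pr B.
Proof.
move=> I1 m1 I2 m2 H A B GA GB.
have mB : measurable B.
  by apply: smallest_sub GB => //; exact: sigma_algebra_measurable.
rewrite setIC mulrC; apply: indep_sigma_r GA => // A' GA'.
by rewrite setIC mulrC; apply: indep_sigma_r GB => //; [exact: m1|move=> *; exact: H].
Qed.

Section blocks.
Context (n : nat) (X : 'I_n -> T -> R).
Hypothesis mX : forall i, measurable_fun setT (X i).
Hypothesis iX : mutually_independent P X.

(** A pi-system generating the sigma-algebra of the coordinates in [K]. *)
Definition cylinder (K : set 'I_n) : set (set T) :=
  [set E | exists A : 'I_n -> set R, [/\ forall i, measurable (A i),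
     forall i, ~ K i -> A i = setT &
     E = \bigcap_(i in [set: 'I_n]) X i @^-1` A i]].

Lemma cylinder_setI K : setI_closed (cylinder K).
Proof.
move=> E F [A [mA AT ->]] [B [mB BT ->]]; exists (fun i => A i `&` B i); split.
- by move=> i; exact: measurableI.
- by move=> i Ki; rewrite AT// BT// setIT.
- by rewrite -bigcapI.
Qed.

Lemma cylinder_measurable K : cylinder K `<=` measurable.
Proof.
move=> E [A [mA AT ->]]; apply: fin_bigcap_measurable => [|i _]; first exact: finite_finset.
by rewrite -[_ @^-1` _]setTI; exact: mX.
Qed.

Lemma cylinder_indep (K L : set 'I_n) : K `&` L = set0 ->
  forall E F, cylinder K E -> cylinder L F -> pr (E `&` F) = pr E * pr F.
Proof.
move=> KL E F cE cF; have mE := cylinder_measurable cE.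
have mF := cylinder_measurable cF.
have mEF := measurableI _ _ mE mF.
apply: EFin_inj; rewrite EFinM -!prE//.
case: cE cF => A [mA AT eE] [B [mB BT eF]].
rewrite eE eF -bigcapI.
under eq_bigcapr do rewrite -preimage_setI.
rewrite !iX//; last by move=> i; exact: measurableI.
rewrite -big_split/=; apply: eq_bigr => i _.
have [Ki|nKi] := pselect (K i).
  rewrite (BT i); first by rewrite setIT preimage_setT probability_setT mule1.
  by move=> Li; suff : set0 i by []; rewrite -KL.
by rewrite (AT i)// setTI preimage_setT probability_setT mul1e.
Qed.

Lemma blocks_indep (K L : set 'I_n) : K `&` L = set0 ->
  forall E F, <<s cylinder K >> E -> <<s cylinder L >> F ->
  pr (E `&` F) = pr E * pr F.
Proof.
move=> KL; apply: indep_sigma.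
- exact: cylinder_setI.
- exact: cylinder_measurable.
- exact: cylinder_setI.
- exact: cylinder_measurable.
- exact: cylinder_indep.
Qed.

Lemma block_measurable_fun (K : set 'I_n) i : K i ->
  measurable_fun [set: g_sigma_algebraType (cylinder K)] (X i : g_sigma_algebraType (cylinder K) -> R).
Proof.
move=> Ki _ Y mY; rewrite setTI; apply: sub_sigma_algebra.
exists (fun j => if j == i then Y else setT); split.
- by move=> j; case: ifP.
- by move=> j; case: eqP => // ->.
- rewrite eqEsubset; split=> w /=.
    by move=> h j _ /=; case: eqP => // ->.
  by move/(_ i I) => /=; rewrite eqxx.
Qed.

End blocks.
End independence.

(** * Brownian motion with everywhere continuous paths *)

(** Brownian motion modified on a null set, so that pathwise arguments have no
   exceptional set. Paths are frozen at negative times, which makes continuity on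
   the whole line available at time [0]. *)
Record continuous_bm d (T : measurableType d) (R : realType)
    (P : probability T R) (W : R -> T -> R) : Prop := {
  cbm_measurable : forall t, measurable_fun setT (W t) ;
  cbm_start : forall w, W 0 w = 0 ;
  cbm_continuous : forall w, continuous (W^~ w) ;
  cbm_independent : forall (n : nat) (t : nat -> R),
    0 <= t 0%N -> (forall i, (i < n)%N -> t i <= t i.+1) ->
    mutually_independent P (fun (i : 'I_n) w => W (t i.+1) w - W (t i) w) ;
  cbm_normal : forall s t, 0 <= s -> s < t ->
    forall A : set R, measurable A ->
      P [set w | A (W t w - W s w)] = normal_prob 0 (Num.sqrt (t - s)) A
}.

Section regularization.
Context d (T : measurableType d) (R : realType) (P : probability T R).

Lemma within_nneg_continuous_max (f : R -> R) :
  {within `[0, +oo[, continuous f} -> continuous (fun t : R => f (Num.max 0 t)).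
Proof.
move=> /subspace_continuousP fc x.
have x0 : 0 <= Num.max 0 x by rewrite le_max lexx.
have := fc (Num.max 0 x); rewrite /= in_itv/= andbT => /(_ x0) cf.
apply/cvgrPdist_lt => e e0; move/cvgrPdist_lt: cf => /(_ e e0).
rewrite near_withinE => -[r /= r0 H]; exists r => //= y /= xy.
apply: H; last by rewrite /= in_itv/= andbT le_max lexx.
rewrite /=; apply: le_lt_trans xy.
have := ler_norm (x - y); have := ler_norm (- (x - y)); rewrite normrN.
by rewrite /Num.max; case: ltP => hx; case: ltP => hy; rewrite ler_norml; lra.
Qed.

Lemma continuous_bm_of_standard (B : R -> {RV P >-> R}) :
  standard_brownian_motion B ->
  exists2 W : R -> T -> R, continuous_bm P W &
    {ae P, forall w, forall t, 0 <= t -> W t w = B t w}.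
Proof.
case=> [[N1 [mN1 PN1 N1B]] [N2 [mN2 PN2 N2B]] iB nB].
pose N := N1 `|` N2.
have mN : measurable N by exact: measurableU.
have PN : P N = 0%E by rewrite measureU0.
pose W t w := B (Num.max 0 t) w * \1_(~` N) w.
have WB t w : 0 <= t -> ~ N w -> W t w = B t w.
  by move=> t0 Nw; rewrite /W max_r// indicE mem_set// mulr1.
have W0 t w : N w -> W t w = 0.
  by move=> Nw; rewrite /W indicE memNset ?mulr0//; exact.
have mW t : measurable_fun setT (W t).
  by apply: measurable_funM => //; exact/measurable_indic/measurableC.
have aeW : {ae P, forall w, ~ N w} by exists N; split => // w /= /contrapT.
have eqP' (E F : set T) : measurable E -> measurable F ->
    (forall w, ~ N w -> E w <-> F w) -> P E = P F.
  by move=> mE mF EF; rewrite !prE//; congr EFin; apply: eq_pr_ae => //; apply: filterS aeW.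
exists W; last by apply: filterS aeW => w Nw t t0; exact: WB.
have mincr (Z : R -> T -> R) s t A : (forall u, measurable_fun setT (Z u)) ->
    measurable A -> measurable [set w | A (Z t w - Z s w)].
  move=> mZ mA; rewrite -[X in measurable X]setTI.
  have : measurable_fun setT (fun w => Z t w - Z s w) by exact: measurable_funB.
  exact.
have mB t : measurable_fun setT (B t) by [].
split=> //.
- move=> w; have [Nw|Nw] := pselect (N w); first exact: W0.
  rewrite WB//; apply: contrapT => nB0; apply: Nw; left; exact: N1B.
- move=> w; have [Nw|Nw] := pselect (N w).
    rewrite (_ : (fun _ => _) = cst 0); first exact: cst_continuous.
    by apply/funext => t; exact: W0.
  rewrite (_ : (fun _ => _) = (fun t => (B^~ w) (Num.max 0 t))); last first.
    by apply/funext => t; rewrite /W indicE mem_set// mulr1.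
  apply: (@within_nneg_continuous_max (fun t => B t w)).
  by apply: contrapT => nc; apply: Nw; right; exact: N2B.
- move=> n t t0 tmono A mA.
  have tge0 i : (i <= n)%N -> 0 <= t i.
    by elim: i => // i IH ni; apply: le_trans (tmono _ ni); exact/IH/ltnW.
  have := iB n t t0 tmono A mA.
  have eqi (i : 'I_n) : P ((fun w => W (t i.+1) w - W (t i) w) @^-1` A i) =
     P ((fun w => B (t i.+1) w - B (t i) w) @^-1` A i).
    apply: eqP'; [exact: mincr|exact: (mincr B)|].
    by move=> w Nw /=; rewrite !WB// tge0// ltnW.
  under [in RHS]eq_bigr do rewrite -eqi.
  move=> <-; apply: eqP'.
  + by apply: fin_bigcap_measurable => // i _; exact: mincr.
  + by apply: fin_bigcap_measurable => // i _; exact: (mincr B).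
  + by move=> w Nw; split=> h i _; have := h i I; rewrite /= !WB// tge0// ltnW.
- move=> s t s0 st A mA; rewrite -nB//; apply: eqP'; [exact: mincr|exact: (mincr B)|].
  by move=> w Nw /=; rewrite !WB// (le_trans s0)// ltW.
Qed.

Lemma continuous_bm_opp W : continuous_bm P W -> continuous_bm P (fun t w => - W t w).
Proof.
move=> [mW W0 cW iW nW]; split.
- by move=> t; exact: measurable_funN.
- by move=> w; rewrite W0 oppr0.
- by move=> w t; apply: cvgN; exact: cW.
- move=> n t t0 tm A mA.
  have := iW n t t0 tm (fun i => -%R @^-1` A i) _.
  have e (i : 'I_n) : (fun w => - W (t i.+1) w - - W (t i) w) @^-1` A i =
      (fun w => W (t i.+1) w - W (t i) w) @^-1` (-%R @^-1` A i).
    by apply/seteqP; split=> w /=; rewrite opprB opprK addrC.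
  rewrite (eq_bigcapr (fun i _ => e i)) (eq_bigr _ (fun i _ => f_equal P (e i))).
  apply => i; rewrite -[X in measurable X]setTI.
  exact: (@oppr_measurable R setT).
- move=> s t s0 st A mA; rewrite -normal_prob_opp//; last first.
    by rewrite gt_eqF// sqrtr_gt0 subr_gt0.
  rewrite -nW//; last by rewrite -[X in measurable X]setTI; exact: (@oppr_measurable R setT).
  by congr (P _); apply/seteqP; split=> w /=; rewrite opprB opprK addrC.
Qed.

End regularization.

Section grids.
Context d (T : measurableType d) (R : realType) (P : probability T R).
Context (W : R -> T -> R) (hW : continuous_bm P W).
Local Notation pr := (Pr P).

Lemma cbm_incr_measurable s t A : measurable A ->
  measurable [set w | A (W t w - W s w)].
Proof.
move=> mA; rewrite -[X in measurable X]setTI.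
have : measurable_fun setT (fun w => W t w - W s w).
  by apply: measurable_funB; exact: (cbm_measurable hW).
exact.
Qed.

(** The form of the Markov property used throughout. Conditions on
   single times of a finite grid suffice: the events of interest are monotone
   limits of such product events along refining grids. *)
Lemma past_future_indep (n k : nat) (t : nat -> R) (A A' : nat -> set R) :
  (k <= n)%N -> 0 <= t 0%N -> (forall i, (i < n)%N -> t i <= t i.+1) ->
  (forall j, measurable (A j)) -> (forall j, measurable (A' j)) ->
  let past := [set w | forall j, (j <= k)%N -> A j (W (t j) w - W (t 0%N) w)] in
  let future :=
    [set w | forall j, (k <= j <= n)%N -> A' j (W (t j) w - W (t k) w)] in
  [/\ measurable past, measurable future &
      pr (past `&` future) = pr past * pr future].
Proof.
move=> kn t0 tm mA mA' past future.
pose X (i : 'I_n) w := W (t i.+1) w - W (t i) w.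
have mX i : measurable_fun setT (X i).
  by apply: measurable_funB; exact: (cbm_measurable hW).
have iX : mutually_independent P X by exact: (cbm_independent hW).
pose blk a b := [set i : 'I_n | (a <= i < b)%N].
have mblk a b j i : (a <= j)%N -> (j <= i)%N -> (i <= b)%N -> (b <= n)%N ->
    measurable_fun [set: g_sigma_algebraType (cylinder X (blk a b))]
    ((fun w => W (t i) w - W (t j) w) : g_sigma_algebraType (cylinder X (blk a b)) -> R).
  move=> aj ji ib bn; elim: i ji ib => [|i IH].
    rewrite leqn0 => /eqP -> _; under eq_fun do rewrite subrr.
    exact: measurable_cst.
  rewrite leq_eqVlt => /predU1P[-> _|ji ib].
    under eq_fun do rewrite subrr; exact: measurable_cst.
  have ni : (i < n)%N by exact: leq_trans bn.
  have -> : (fun w => W (t i.+1) w - W (t j) w) =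
      (fun w => (W (t i) w - W (t j) w) + X (Ordinal ni) w).
    by apply/funext => w; rewrite /X/=; lra.
  apply: measurable_funD; first by apply: IH => //; exact: ltnW.
  by apply: block_measurable_fun; rewrite /blk/= ib (leq_trans aj).
have sp : <<s cylinder X (blk 0 k) >> past.
  rewrite (_ : past = \bigcap_(j in [set j | (j <= k)%N])
      [set w | A j (W (t j) w - W (t 0%N) w)]); last first.
    by apply/seteqP; split.
  suff : measurable (\bigcap_(j in [set j | (j <= k)%N])
      [set w : g_sigma_algebraType (cylinder X (blk 0 k)) | A j (W (t j) w - W (t 0%N) w)]) by [].
  apply: bigcap_measurableType => j /= jk.
  by rewrite -[X in measurable X]setTI; apply: mblk.
have sf : <<s cylinder X (blk k n) >> future.
  rewrite (_ : future = \bigcap_(j in [set j | (k <= j <= n)%N])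
      [set w | A' j (W (t j) w - W (t k) w)]); last first.
    by apply/seteqP; split.
  suff : measurable (\bigcap_(j in [set j | (k <= j <= n)%N])
      [set w : g_sigma_algebraType (cylinder X (blk k n)) | A' j (W (t j) w - W (t k) w)]) by [].
  apply: bigcap_measurableType => j /= /andP[kj jn].
  by rewrite -[X in measurable X]setTI; apply: mblk.
have sm K : <<s cylinder X K >> `<=` @measurable d T.
  apply: smallest_sub; first exact: sigma_algebra_measurable.
  exact: cylinder_measurable.
split; [exact: sm sp|exact: sm sf|].
apply: (blocks_indep mX iX _ sp sf).
by apply/seteqP; split=> // i [] /=; rewrite /blk/=; lia.
Qed.

End grids.

(** * Sums with an independent atomless variable *)

Section anticoncentration.
Context d (T : measurableType d) (R : realType) (P : probability T R).
Local Notation pr := (Pr P).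

Lemma pr_tight (Z : T -> R) : measurable_fun setT Z -> forall e, 0 < e ->
  exists K : nat, pr [set w | K%:R < `|Z w|] < e.
Proof.
move=> mZ e e0.
have mF (n : nat) : measurable [set w | n%:R < `|Z w|].
  rewrite -[X in measurable X]setTI.
  have : measurable_fun setT (fun w => `|Z w|) by exact: measurableT_comp.
  by move=> /(_ measurableT _ (measurable_itv `]n%:R, +oo[)); rewrite preimage_itvoy.
have [n w /=|N /(_ N (leqnn _))] := pr_nonincreasing P mF _ e0.
  by apply: le_lt_trans; rewrite ler_nat.
rewrite (_ : \bigcap_n _ = set0) ?pr0 ?add0r; first by exists N.
apply/seteqP; split=> // w /= h; have := h (Num.bound `|Z w|) I => /=.
by rewrite ltNge => /negP; apply; apply: ltW; exact: archi_boundP.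
Qed.

(** Adding an independent [V] to [Z] does not destroy a bound on concentration.
   The variable [V], possibly infinite, is given by the events [U a] that stand for
   [V <= a], and [E] for [- e < Z + V <= 0]. If [- Z] lies in the cell
   [[k e, (k + 1) e[] then [E] forces [V] into an interval of length [2 e]; summing
   over [k], the probabilities of these intervals telescope. *)
Lemma pr_indep_sum_le (Z : T -> R) (U : R -> set T) (C e : R) (E : set T) :
  measurable_fun setT Z -> (forall a, measurable (U a)) ->
  (forall a b, a <= b -> U a `<=` U b) ->
  (forall a b, a <= b -> pr [set w | a < Z w <= b] <= C * (b - a)) ->
  (forall a b c, pr ([set w | a < Z w <= b] `&` U c) =
     pr [set w | a < Z w <= b] * pr (U c)) ->
  0 <= C -> 0 < e -> measurable E ->
  (forall w, E w -> U (- Z w) w /\ ~ U (- Z w - e) w) ->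
  pr E <= 2 * C * e.
Proof.
move=> mZ mU Umono ZC ZU C0 e0 mE EU.
have mJ a b : measurable [set w | a < Z w <= b].
  rewrite -[X in measurable X]setTI.
  have := mZ measurableT _ (measurable_itv `]a, b]).
  by congr (measurable (_ `&` _)); apply/seteqP; split=> w /=; rewrite in_itv.
apply/ler_addgt0Pr => r r0.
have [K' HK'] := pr_tight mZ r0.
(* outside of [2 N] cells of length [e] around [0] the mass of [Z] is below [r] *)
pose N := (Num.bound (K'%:R / e)).+1.
have KN : K'%:R < N%:R * e.
  rewrite -ltr_pdivrMr// /N; apply: lt_le_trans (_ : (Num.bound (K'%:R / e))%:R <= _).
    by have := archi_boundP (divr_ge0 (ler0n R K') (ltW e0)).
  by rewrite ler_nat.
pose a (i : nat) : R := (i%:R - N%:R) * e.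
have aS i : a i.+1 = a i + e by rewrite /a -natr1; ring.
pose v x := pr (U x).
have vmono x y : x <= y -> v x <= v y by move=> xy; apply: le_pr => //; exact: Umono.
have v01 x : 0 <= v x <= 1 by rewrite pr_ge0 pr_le1.
pose J i := [set w | - a i.+1 < Z w <= - a i].
pose F i := J i `&` (U (a i.+1) `\` U (a i - e)).
have mF i : measurable (F i).
  by apply: measurableI; [exact: mJ|exact: measurableD].
have mtail : measurable [set w | K'%:R < `|Z w|].
  rewrite -[X in measurable X]setTI.
  have : measurable_fun setT (fun w => `|Z w|) by exact: measurableT_comp.
  by move=> /(_ measurableT _ (measurable_itv `]K'%:R, +oo[)); rewrite preimage_itvoy.
have EF : E `<=` [set w | K'%:R < `|Z w|] `|` \big[setU/set0]_(i < (2 * N)%N) F i.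
  move=> w Ew; have [?|ZK] := ltP K'%:R `|Z w|; first by left.
  right; rewrite -bigcup_mkord.
  have : `|- Z w| < N%:R * e by rewrite normrN; exact: le_lt_trans KN.
  rewrite ltr_norml => /andP[h1 h2].
  have Nz0 : 0 <= - Z w / e + N%:R by rewrite -lerBlDr sub0r ler_pdivlMr// mulNr ltW.
  pose i := Num.truncn (- Z w / e + N%:R).
  have /andP[i1 i2] : i%:R <= - Z w / e + N%:R < i.+1%:R by exact: truncn_itv.
  have ai : a i <= - Z w by rewrite /a -ler_pdivlMr// lerBlDr.
  have aiS : - Z w < a i.+1 by rewrite /a -ltr_pdivrMr// ltrBrDr.
  exists i.
    rewrite /= -(ltr_nat R) natrM (le_lt_trans i1)//.
    have : - Z w / e < N%:R by rewrite ltr_pdivrMr.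
    lra.
  have [U1 U2] := EU w Ew; split; first by rewrite /J/=; lra.
  split; first by apply: Umono U1; exact: ltW.
  by move=> h; apply: U2; apply: Umono h; lra.
have prF i : pr (F i) <= C * e * ((v (a i.+1) - v (a i)) + (v (a i) - v (a i - e))).
  have UU : U (a i - e) `<=` U (a i.+1) by apply: Umono; rewrite aS; lra.
  have -> : pr (F i) = pr (J i) * (v (a i.+1) - v (a i - e)).
    have := pr_setID P (measurableI _ _ (mJ (- a i.+1) (- a i)) (mU (a i.+1))) (mU (a i - e)).
    rewrite -setIA (setIidr UU) -setIDA !ZU -/(J i) -/(F i) /v; lra.
  have -> : v (a i.+1) - v (a i) + (v (a i) - v (a i - e)) = v (a i.+1) - v (a i - e) by ring.
  apply: ler_wpM2r; first by rewrite subr_ge0 vmono// aS; lra.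
  apply: le_trans (ZC _ _ _) _; first by rewrite aS; lra.
  by rewrite le_eqVlt aS; apply/orP; left; apply/eqP; ring.
have mB : measurable (\big[setU/set0]_(i < (2 * N)%N) F i).
  exact: bigsetU_measurable.
have h1 := le_pr P mE (measurableU _ _ mtail mB) EF.
have h2 := pr_setU_le P mtail mB.
have h3 := pr_bigcup_le P (index_enum 'I_(2 * N)) (fun i : 'I_(2 * N) => mF i).
suff : \sum_(i < 2 * N) pr (F i) <= 2 * C * e by lra.
apply: le_trans (ler_sum _ (fun (i : 'I_(2 * N)) _ => prF i)) _.
have -> : 2 * C * e = C * e * 2 by ring.
rewrite -mulr_sumr; apply: ler_wpM2l; first by apply: mulr_ge0 => //; exact: ltW.
rewrite big_split/= -(big_mkord xpredT (fun i => v (a i.+1) - v (a i))).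
rewrite -(big_mkord xpredT (fun i => v (a i) - v (a i - e))).
rewrite telescope_sumr//.
have -> : \sum_(0 <= i < 2 * N) (v (a i) - v (a i - e)) =
    \sum_(0 <= i < 2 * N) ((fun i => v (a i - e)) i.+1 - (fun i => v (a i - e)) i).
  by apply: eq_bigr => i _ /=; rewrite aS addrK.
rewrite telescope_sumr//.
have := v01 (a (2 * N)%N); have := v01 (a 0%N); have := v01 (a (2 * N)%N - e).
have := v01 (a 0%N - e). lra.
Qed.

End anticoncentration.

(** * Dyadic grids and suprema of Brownian motion over a barrier *)

Section dyadic.
Context (R : realType).
Implicit Types a b t : R.

(** Dyadic times rather than rational ones: each level is an increasing sequence
   of times, as independence of increments requires, and the levels are nested. *)
Definition dyad a b (m i : nat) : R := a + (b - a) * (i%:R / 2 ^+ m).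

Lemma dyad0 a b m : dyad a b m 0 = a.
Proof. by rewrite /dyad mul0r mulr0 addr0. Qed.

Lemma dyad_double a b m i : dyad a b m.+1 (2 * i) = dyad a b m i.
Proof.
by rewrite /dyad natrM exprS; congr (_ + _ * _); field; rewrite expf_neq0.
Qed.

Lemma dyad_shift a b m k i : dyad a b (m + k) (2 ^ k * i) = dyad a b m i.
Proof.
elim: k => [|k IH]; first by rewrite addn0 expn0 mul1n.
by rewrite addnS expnS -mulnA dyad_double.
Qed.

Lemma dyad_max a b m : dyad a b m (2 ^ m) = b.
Proof. by rewrite /dyad natrX divff ?expf_neq0// mulr1 addrC subrK. Qed.

Lemma le_dyad a b m i j : a <= b -> (i <= j)%N -> dyad a b m i <= dyad a b m j.
Proof.
move=> ab ij; rewrite lerD2l ler_wpM2l ?subr_ge0// ler_wpM2r ?invr_ge0 ?exprn_ge0//.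
by rewrite ler_nat.
Qed.

Lemma dyad_ge a b m i : a <= b -> a <= dyad a b m i.
Proof. by move=> ab; rewrite -[leLHS](dyad0 a b m) le_dyad. Qed.

Lemma dyad_le a b m i : a <= b -> (i <= 2 ^ m)%N -> dyad a b m i <= b.
Proof. by move=> ab im; rewrite -[leRHS](dyad_max a b m) le_dyad. Qed.

Lemma dyad_gt a b m i : a < b -> (0 < i)%N -> a < dyad a b m i.
Proof.
by move=> ab i0; rewrite /dyad ltrDl mulr_gt0 ?subr_gt0// divr_gt0 ?ltr0n ?exprn_gt0.
Qed.

Lemma dyad_dense a b t e : a < b -> a <= t <= b -> 0 < e ->
  exists m i, [/\ (i <= 2 ^ m)%N, dyad a b m i <= t & t - e < dyad a b m i].
Proof.
move=> ab /andP[at_ tb] e0; have ba : 0 < b - a by rewrite subr_gt0.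
pose m := Num.bound ((b - a) / e); exists m.
have mE : (b - a) / e < 2 ^+ m.
  apply: lt_le_trans (archi_boundP _) _; first by rewrite divr_ge0// ltW.
  by rewrite -natrX ler_nat ltnW// ltn_expl.
have p0 : 0 < 2 ^+ m :> R by rewrite exprn_gt0.
pose x := (t - a) / (b - a) * 2 ^+ m.
have x0 : 0 <= x by rewrite /x mulr_ge0 ?(ltW p0)// divr_ge0 ?(ltW ba)// subr_ge0.
have xm : x <= 2 ^+ m.
  by rewrite -[leRHS]mul1r ler_wpM2r ?(ltW p0)// ler_pdivrMr// mul1r; lra.
exists (Num.truncn x); have /andP[i1 i2] := truncn_itv x0; set i := Num.truncn x in i1 i2 *.
have tE : t = a + (b - a) * (x / 2 ^+ m).
  by rewrite /x; field; rewrite !gt_eqF.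
split.
- by rewrite -(ler_nat R) natrX (le_trans i1).
- by rewrite [leRHS]tE lerD2l ler_pM2l// ler_pM2r ?invr_gt0.
- rewrite {1}tE /dyad -addrA ltrD2l ltrBlDr -ltrBlDl -mulrBr -mulrBl.
  rewrite mulrA ltr_pdivrMr//.
  have : (b - a) < e * 2 ^+ m by rewrite mulrC -ltr_pdivrMr.
  apply: le_lt_trans; rewrite -[leRHS]mulr1 ler_pM2l//.
  by move: i2; rewrite -natr1; lra.
Qed.

End dyadic.

Section brownian_estimates.
Context d (T : measurableType d) (R : realType) (P : probability T R).
Context (W : R -> T -> R) (hW : continuous_bm P W).
Local Notation pr := (Pr P).

Lemma incr_density s t : 0 <= s -> s < t ->
  exists2 C, 0 <= C & forall a b, a <= b ->
    pr [set w | a < W t w - W s w <= b] <= C * (b - a).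
Proof.
move=> s0 st; exists (normal_peak (Num.sqrt (t - s))); first exact: normal_peak_ge0.
move=> a b ab.
have -> : [set w | a < W t w - W s w <= b] = [set w | `]a, b]%classic (W t w - W s w)].
  by apply/seteqP; split=> w /=; rewrite in_itv.
rewrite -lee_fin -prE; last exact: (cbm_incr_measurable hW).
rewrite (cbm_normal hW)// normal_prob_le//.
by rewrite gt_eqF// sqrtr_gt0 subr_gt0.
Qed.

Lemma cbm_value_measurable t A : measurable A -> measurable [set w | A (W t w)].
Proof.
by move=> mA; rewrite -[X in measurable X]setTI; exact: (cbm_measurable hW).
Qed.

Lemma no_atom s x : 0 < s -> pr [set w | W s w = x] = 0.
Proof.
move=> s0; have [C C0 HC] := incr_density (lexx 0) s0.
apply/eqP; rewrite eq_le pr_ge0 andbT; apply/ler_addgt0Pr => e e0; rewrite add0r.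
pose r := e / (C + 1).
have r0 : 0 < r by rewrite divr_gt0//; lra.
have mB : measurable [set w | x - r < W s w - W 0 w <= x].
  have -> : [set w | x - r < W s w - W 0 w <= x] = [set w | `]x - r, x]%classic (W s w - W 0 w)].
    by apply/seteqP; split=> w /=; rewrite in_itv.
  exact: (cbm_incr_measurable hW).
apply: (@le_trans _ _ (pr [set w | x - r < W s w - W 0 w <= x])).
  apply: le_pr => //; first exact: (@cbm_value_measurable s [set x]).
  by move=> w /= ->; rewrite (cbm_start hW) subr0; lra.
apply: le_trans (HC _ _ _) _; first lra.
rewrite opprB addrC subrK /r mulrA ler_pdivrMr; last lra.
by rewrite mulrC ler_wpM2l//; lra.
Qed.

(** The supremum of [W - f] over a time interval bounded away from [0] has no
   atom at [0], since it is the sum of [W a] and an independent variable. *)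
Lemma sup_dyadic_gap a b (f : R -> \bar R) : 0 < a -> a < b ->
  {ae P, forall w,
    (forall e, 0 < e -> exists m i, (i <= 2 ^ m)%N /\
       (f (dyad a b m i) < (W (dyad a b m i) w + e)%:E)%E) ->
    exists m i, (i <= 2 ^ m)%N /\
       (f (dyad a b m i) < (W (dyad a b m i) w)%:E)%E}.
Proof.
move=> a0 ab; have [C C0 HC] := incr_density (lexx 0) a0.
pose q := dyad a b.
pose below m r := [set w | forall i, (i <= 2 ^ m)%N -> ((W (q m i) w - r)%:E <= f (q m i))%E].
have mbelow m r : measurable (below m r).
  rewrite (_ : below m r = \bigcap_(i in [set i | (i <= 2 ^ m)%N])
    [set w | ((W (q m i) w - r)%:E <= f (q m i))%E]); last by apply/seteqP; split.
  apply: bigcap_measurableType => i _.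
  apply: (@cbm_value_measurable (q m i) [set x | ((x - r)%:E <= f (q m i))%E]).
  rewrite -[X in measurable X]setTI; apply: emeasurable_fun_infty_c => //.
  by apply/measurable_EFinP; exact: measurable_funB.
pose E m e := below m 0 `\` below m (- e).
have mE m e : measurable (E m e) by exact: measurableD.
have prE_le m e : 0 < e -> pr (E m e) <= 2 * C * e.
  move=> e0.
  (* the grid starts at [0], so that its first increment is [W a] *)
  pose t j := if j is j'.+1 then q m j' else 0.
  pose U r := [set w | forall j, (1 <= j <= (2 ^ m).+1)%N ->
    [set x | ((x - r)%:E <= f (t j))%E] (W (t j) w - W (t 1%N) w)].
  have t1 : t 1%N = a by rewrite /t /q dyad0.
  have tm i : (i < (2 ^ m).+1)%N -> t i <= t i.+1.
    case: i => [_|i _]; first by rewrite /t /q dyad0 ltW.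
    by apply: le_dyad; first exact: ltW.
  have mA r j : measurable [set x | ((x - r)%:E <= f (t j))%E].
    rewrite -[X in measurable X]setTI; apply: emeasurable_fun_infty_c => //.
    by apply/measurable_EFinP; exact: measurable_funB.
  have indep c1 c2 r := @past_future_indep _ _ _ _ _ hW (2 ^ m).+1 1 t
    (fun j => if j == 1%N then `]c1, c2]%classic else setT)
    (fun j => [set x | ((x - r)%:E <= f (t j))%E])
    isT (lexx 0) tm (fun j => if_measurable (j == 1%N) (measurable_itv `]c1, c2]) measurableT) (mA r).
  have pastE c1 c2 : [set w | forall j, (j <= 1)%N ->
      (if j == 1%N then `]c1, c2]%classic else setT) (W (t j) w - W (t 0%N) w)] =
      [set w | c1 < W a w - W 0 w <= c2].
    apply/seteqP; split=> w /=.
      by move=> /(_ 1%N isT); rewrite /= /q dyad0 in_itv.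
    by move=> h [|[|//]] _ //=; rewrite /q dyad0 in_itv.
  apply: (@pr_indep_sum_le _ _ _ P (fun w => W a w - W 0 w) U) => //.
  - by apply: measurable_funB; exact: (cbm_measurable hW).
  - by move=> r; have [_] := indep 0 0 r.
  - move=> r r' rr' w h j jm; apply: le_trans (h j jm); rewrite lee_fin; lra.
  - by move=> c1 c2 c; have [_ _] := indep c1 c2 c; rewrite pastE.
  - move=> w [b0 be]; have eqU r : U (- (W a w - W 0 w) + r) w <-> below m r w.
      split=> h.
        move=> i im; have := h i.+1 im; rewrite t1 /= (cbm_start hW).
        by congr (_%:E <= _)%E; ring.
      move=> [//|j] jm; have := h j jm; rewrite t1 /= (cbm_start hW).
      by congr (_%:E <= _)%E; ring.
    by split; [rewrite -[X in U X]addr0; exact/eqU|move/eqU].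
pose L k := \bigcup_n \bigcap_(m in [set m | (n <= m)%N]) E m k.+1%:R^-1.
have mL k : measurable (L k).
  by apply: bigcup_measurable => n _; exact: bigcap_measurableType.
have prL k : pr (L k) <= (2 * C + 1) * k.+1%:R^-1.
  have [||N /(_ N (leqnn _))] := @pr_liminf _ _ _ P (L k) (E ^~ k.+1%:R^-1)
    (mL k) (fun m => mE m _) _ k.+1%:R^-1; last first.
  - have := @prE_le N k.+1%:R^-1 _; rewrite invr_gt0 ltr0n => /(_ isT) /=.
    by set r := _^-1; move=> h1 h2; rewrite mulrDl mul1r; lra.
  - by rewrite invr_gt0 ltr0n.
  - by apply: aeW => w [n _ h]; exists n.
pose G := \bigcap_k L k.
have mG : measurable G by exact: bigcap_measurableType.
have G0 : pr G = 0.
  apply/eqP; rewrite eq_le pr_ge0 andbT; apply/ler_addgt0Pr => e e0; rewrite add0r.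
  pose k := Num.bound ((2 * C + 1) / e).
  apply: le_trans (_ : pr (L k) <= _); first by apply: le_pr => // w; exact.
  apply: le_trans (prL k) _; rewrite ler_pdivrMr ?ltr0n// [leRHS]mulrC -ler_pdivrMr//.
  have hk : (2 * C + 1) / e < k%:R.
    by apply: archi_boundP; apply: divr_ge0; [lra|exact: ltW].
  by apply: ltW; apply: lt_le_trans hk _; rewrite ler_nat.
have /(ae_pr0P _ mG) := G0; apply: filterS => w nG hw; apply: contrapT => nh.
have bw m r : 0 <= r -> below m r w.
  move=> r0 i im; rewrite leNgt; apply/negP => h; apply: nh; exists m, i; split => //.
  by apply: lt_le_trans h _; rewrite lee_fin; lra.
apply: nG => k _; have k0 : 0 < k.+1%:R^-1 :> R by rewrite invr_gt0.
have [m [i [im hi]]] := hw _ k0.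
exists m => // n /= mn; split; first exact: bw.
have qE : q n (2 ^ (n - m) * i)%N = q m i by rewrite -{1}(subnKC mn) /q dyad_shift.
have inm : (2 ^ (n - m) * i <= 2 ^ n)%N.
  by rewrite -{2}(subnK mn) expnD leq_mul2l im orbT.
by move=> /(_ _ inm); rewrite qE opprK leNgt hi.
Qed.

End brownian_estimates.

(** * Unbounded paths and the maximal inequality *)

Section brownian_paths.
Context d (T : measurableType d) (R : realType) (P : probability T R).
Context (W : R -> T -> R) (hW : continuous_bm P W).
Local Notation pr := (Pr P).

(** Let [a] be the probability that the path stays below [M] at all integer times.
   Wait until the probability of being below [M] so far is almost [a]; the next
   increment over a long enough time exceeds any given bound with a probability [p]
   independent of the past, so that [a <= a * (1 - p)] and [a] vanishes. *)
Lemma cbm_unbounded_nat (M : R) : pr [set w | forall i : nat, W i%:R w <= M] = 0.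
Proof.
pose A n := [set w | forall i : nat, (i <= n)%N -> W i%:R w <= M].
have mA n : measurable (A n).
  rewrite (_ : A n = \bigcap_(i in [set i | (i <= n)%N]) [set w | W i%:R w <= M]).
    apply: bigcap_measurableType => i _.
    rewrite (_ : [set w | _] = [set w | `]-oo, M]%classic (W i%:R w)]).
      exact: (cbm_value_measurable hW).
    by apply/seteqP; split=> w /=; rewrite in_itv.
  by apply/seteqP; split.
rewrite (_ : [set w | _] = \bigcap_n A n); last first.
  apply/seteqP; split=> w /= h; first by move=> n _ i _; exact: h.
  by move=> i; exact: (h i I i).
set a := pr _.
have [p p0 hp] := @normal_prob_gt_sigma R.
have step e : 0 < e -> p * a <= 2 * e.
  move=> e0.
  have [n w /= h i ni|n /(_ n (leqnn _)) hn] := pr_nonincreasing P mA _ e0.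
    exact/h/leqW.
  have [K hK] := pr_tight P (cbm_measurable hW n%:R) e0.
  (* after time [n] wait for [l ^ 2], so that the increment has deviation [l] *)
  pose l := (Num.bound `|M| + K).+1.
  have lM : M + K%:R <= l%:R.
    have := archi_boundP (normr_ge0 M); have := ler_norm M.
    by rewrite /l -natr1 natrD; lra.
  have l0 : 0 < l%:R :> R by rewrite ltr0n.
  pose n' := (n + l ^ 2)%N.
  have nn' : (n <= n')%N by exact: leq_addr.
  have nn'R : n%:R < n'%:R :> R by rewrite ltr_nat /n' -[ltnLHS]addn0 ltn_add2l expn_gt0.
  have natS i : (i < n')%N -> i%:R <= i.+1%:R :> R by rewrite ler_nat.
  have [mp mf pf] := @past_future_indep _ _ _ _ _ hW n' n (fun i => i%:R)
    (fun=> `]-oo, M]%classic)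
    (fun j => if j == n' then `]-oo, l%:R]%classic else setT)
    nn' (lexx _) natS (fun=> measurable_itv _)
    (fun j => if_measurable (j == n') (measurable_itv `]-oo, l%:R]) measurableT).
  set past := [set w | _] in mp pf; set fut := [set w | _] in mf pf.
  have pastE : past = A n.
    by apply/seteqP; split=> w /= h i /h; rewrite /= in_itv/= (cbm_start hW) subr0.
  pose D := [set w | `]l%:R, +oo[%classic (W n'%:R w - W n%:R w)].
  have mD : measurable D by exact: (cbm_incr_measurable hW).
  have futE : fut = ~` D.
    apply/seteqP; split=> w /=.
      move=> /(_ n'); rewrite leqnn nn' eqxx => /(_ isT).
      by rewrite /D /= !in_itv/= andbT => h; apply/negP; rewrite -leNgt.
    move=> h j _; case: eqP => // ->; rewrite /= in_itv/=.
    by rewrite leNgt; apply/negP => h'; apply: h; rewrite /D/= in_itv/= andbT.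
  have pD : p <= pr D.
    rewrite -lee_fin -prE// /D (cbm_normal hW)//.
    have -> : n'%:R - n%:R = l%:R ^+ 2 :> R by rewrite /n' natrD natrX addrC addKr.
    by rewrite sqrtr_sqr gtr0_norm//; exact: hp.
  have mT : measurable [set w | K%:R < `|W n%:R w|].
    rewrite (_ : [set w | _] = [set w | [set x | K%:R < `|x|] (W n%:R w)]) //.
    apply: (cbm_value_measurable hW).
    rewrite -[X in measurable X]setTI.
    have : measurable_fun setT (fun x : R => `|x|) by exact: normr_measurable.
    by move=> /(_ measurableT _ (measurable_itv `]K%:R, +oo[)); rewrite preimage_itvoy.
  have h1 : pr (A n') <= pr ((past `&` fut) `|` [set w | K%:R < `|W n%:R w|]).
    apply: le_pr => //; first by apply: measurableU => //; exact: measurableI.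
    move=> w /= h; have [?|hk] := ltP K%:R `|W n%:R w|; [by right|left].
    rewrite pastE futE; split; first by move=> i ni; apply: h; exact: leq_trans nn'.
    rewrite /D/= in_itv/= andbT => hl; have := h n' (leqnn _).
    move: hk; rewrite ler_norml; lra.
  have h2 := pr_setU_le P (measurableI _ _ mp mf) mT.
  have h3 : a <= pr (A n').
    by apply: le_pr => //; [exact: bigcap_measurableType|move=> w; exact].
  have h4 : pr (past `&` fut) <= pr (A n) * (1 - p).
    rewrite pf pastE futE pr_setC// ler_wpM2l ?pr_ge0//; lra.
  have a0 : 0 <= a by exact: pr_ge0.
  have : pr (A n) * (1 - p) <= (a + e) * (1 - p).
    rewrite ler_wpM2r//; last exact: ltW.
    have := pr_le1 P mD; lra.
  nra.
apply/eqP; rewrite eq_le pr_ge0 andbT; apply/ler_addgt0Pr => e e0; rewrite add0r.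
have pe0 : 0 < p * e / 2 by rewrite divr_gt0// mulr_gt0.
have e2 : 2 * (p * e / 2) = p * e by field.
by have := step _ pe0; rewrite e2 ler_pM2l.
Qed.

Lemma cbm_unbounded :
  {ae P, forall w, forall M : R, exists2 t, 0 < t & M < W t w}.
Proof.
have : {ae P, forall w, forall n : nat, ~ [set w | forall i : nat, W i%:R w <= n%:R] w}.
  apply: ae_foralln => n; apply/ae_pr0P; last exact: cbm_unbounded_nat.
  rewrite (_ : [set w | _] = \bigcap_i [set w | `]-oo, n%:R]%classic (W i%:R w)]).
    by apply: bigcap_measurableType => i _; exact: (cbm_value_measurable hW).
  by apply/seteqP; split=> w /= h i; have := h i; rewrite /= in_itv; [|move=> /(_ I)].
apply: filterS => w h M.
have := h (Num.bound `|M|); rewrite /= => /existsNP[i /negP]; rewrite -ltNge => hi.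
have hM : M < W i%:R w.
  apply: lt_trans hi; apply: le_lt_trans (ler_norm M) _; exact: archi_boundP.
have hi0 : 0 < W i%:R w by apply: le_lt_trans hi.
exists i%:R => //; rewrite ltr0n lt0n; apply/eqP => i0; move: hi0.
by rewrite i0 (cbm_start hW) ltxx.
Qed.

Let incr_set s t (Q : R -> Prop) : measurable [set x | Q x] ->
  measurable [set w | Q (W t w - W s w)].
Proof. by move=> mQ; exact: (cbm_incr_measurable hW s t mQ). Qed.

Let mge (x : R) : measurable [set y : R | x <= y].
Proof. by rewrite -set_itvcy. Qed.
Let mlt (x : R) : measurable [set y : R | y < x].
Proof. by rewrite -set_itvNyo. Qed.
Let mle (x : R) : measurable [set y : R | y <= x].
Proof. by rewrite -set_itvNyc. Qed.

Lemma incr_sym s t x : 0 <= s -> s < t ->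
  pr [set w | x <= W t w - W s w] = pr [set w | W t w - W s w <= - x].
Proof.
move=> s0 st; apply: EFin_inj; rewrite -!prE; [|exact: (incr_set s t (mle (- x)))|exact: (incr_set s t (mge x))].
rewrite (cbm_normal hW s0 st (mge x)) (cbm_normal hW s0 st (mle (- x))).
rewrite -normal_prob_opp//; first by congr normal_prob; apply/seteqP; split=> y /=; lra.
by rewrite gt_eqF// sqrtr_gt0 subr_gt0.
Qed.

Lemma incr_half s t : 0 <= s -> s <= t -> 1 <= 2 * pr [set w | 0 <= W t w - W s w].
Proof.
move=> s0; rewrite le_eqVlt => /predU1P[->|st].
  rewrite (_ : [set w | _] = setT) ?prT; first lra.
  by apply/seteqP; split=> // w _ /=; rewrite subrr.
have := incr_sym 0 s0 st; rewrite oppr0.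
have := pr_setU_le P (incr_set s t (mge 0)) (incr_set s t (mle 0)).
rewrite (_ : _ `|` _ = setT) ?prT; first lra.
by apply/seteqP; split=> // w _ /=; case: (lerP 0 (W t w - W s w)) => h; [left|right; exact: ltW].
Qed.

Lemma incr_tail s t x : 0 <= s -> s < t -> 0 < x ->
  2 * pr [set w | x <= W t w - W s w] < 1.
Proof.
move=> s0 st x0; set sg := Num.sqrt (t - s).
have sg0 : 0 < sg by rewrite sqrtr_gt0 subr_gt0.
pose M := [set w | `]0, x / 2]%classic (W t w - W s w)].
have mM : measurable M by exact: (cbm_incr_measurable hW).
have pM : 0 < pr M.
  pose c := normal_pdf 0 sg (x / 2).
  have c0 : 0 < c.
    by rewrite /c normal_pdfE ?gt_eqF// mulr_gt0 ?expR_gt0// normal_peak_gt0// gt_eqF.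
  apply: (@lt_le_trans _ _ (c * (x / 2 - 0))); first by rewrite mulr_gt0//; lra.
  rewrite -lee_fin -prE// /M (cbm_normal hW)//; apply: normal_prob_ge; [lra|exact: ltW|].
  move=> y /andP[y0 yx]; rewrite /c !normal_pdfE ?gt_eqF// ler_wpM2l ?normal_peak_ge0//.
  rewrite /normal_fun !subr0 ler_expR ler_pM2r; first by rewrite lerN2; nra.
  by rewrite invr_gt0 pmulrn_lgt0// exprn_gt0.
have m1 := incr_set s t (mge x); have m2 := incr_set s t (mle (- x)).
have e1 : pr ([set w | x <= W t w - W s w] `|` [set w | W t w - W s w <= - x]) =
    2 * pr [set w | x <= W t w - W s w].
  rewrite pr_setU_disj//; first by rewrite -incr_sym//; lra.
  by apply/seteqP; split=> // w /=; lra.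
have m12 := measurableU _ _ m1 m2.
have e2 := @pr_setU_disj _ _ _ P _ M m12 mM.
have := pr_le1 P (measurableU _ _ m12 mM); rewrite e2 ?e1; first lra.
by apply/seteqP; split=> // w; rewrite /M /= in_itv/= => -[h1 /andP[h2 h3]]; case: h1 => h1; lra.
Qed.

(** Lévy's maximal inequality: after the first index at which the level is
   exceeded, the remaining increment is independent of the past and nonnegative
   with probability at least one half. *)
Lemma levy_maximal (t : nat -> R) (n : nat) (x : R) :
  0 <= t 0%N -> (forall i, (i < n)%N -> t i <= t i.+1) ->
  pr [set w | exists2 i, (i <= n)%N & x <= W (t i) w - W (t 0%N) w] <=
  2 * pr [set w | x <= W (t n) w - W (t 0%N) w].
Proof.
move=> t0 tm.
have tmn i j : (i <= j)%N -> (j <= n)%N -> t i <= t j.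
  move=> ij; rewrite -(subnKC ij); elim: (j - i)%N => [|k IH]; first by rewrite addn0.
  by rewrite addnS => h; apply: le_trans (tm _ h); exact/IH/ltnW.
pose S i w := W (t i) w - W (t 0%N) w.
pose D k := [set w | exists2 i, (i <= k)%N & x <= S i w].
pose H := [set w | x <= S n w].
have mS i : measurable [set w | x <= S i w] by exact: (incr_set _ _ (mge x)).
have mD k : measurable (D k).
  rewrite (_ : D k = \bigcup_(i in [set i | (i <= k)%N]) [set w | x <= S i w]).
    exact: bigcup_measurable.
  by apply/seteqP; split.
have mH : measurable H by exact: mS.
pose F k := [set w | x <= S k w] `\` \bigcup_(i in [set i | (i < k)%N]) [set w | x <= S i w].
have mF k : measurable (F k) by apply: measurableD => //; exact: bigcup_measurable.
have FH k : (k <= n)%N -> pr (F k) <= 2 * pr (F k `&` H).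
  move=> kn.
  have [mp mf pf] := @past_future_indep _ _ _ _ _ hW n k t
    (fun j => if j == k then [set y | x <= y] else [set y | y < x])
    (fun j => if j == n then [set y | 0 <= y] else setT)
    kn t0 tm
    (fun j => if_measurable (j == k) (mge x) (mlt x))
    (fun j => if_measurable (j == n) (mge 0) measurableT).
  set past := [set w | _] in mp pf; set fut := [set w | _] in mf pf.
  have pastE : past = F k.
    apply/seteqP; split=> w /=.
      move=> h; split; first by have := h k (leqnn _); rewrite eqxx.
      move=> [i /= ik hi]; have := h i (ltnW ik); rewrite ltn_eqF//= => h'.
      by move: (lt_le_trans h' hi); rewrite ltxx.
    move=> [h1 h2] j jk; case: eqP => [->//|/eqP jnk] /=.
    by rewrite ltNge; apply/negP => h; apply: h2; exists j => //=; rewrite ltn_neqAle jnk.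
  have futE : fut = [set w | 0 <= W (t n) w - W (t k) w].
    apply/seteqP; split=> w /=.
      by move=> /(_ n); rewrite leqnn kn eqxx => /(_ isT).
    by move=> h j _; case: eqP => // ->.
  have hl : pr (past `&` fut) <= pr (F k `&` H).
    apply: le_pr; [exact: measurableI|exact: measurableI|].
    rewrite pastE futE => w [Fw /= h]; split => //; case: Fw => /= h1 _.
    by rewrite /H/= /S; move: h1; rewrite /S; lra.
  have : 1 <= 2 * pr fut by rewrite futE; apply: incr_half; [exact: le_trans t0 (tmn 0%N k _ _)|exact: tmn].
  have : 0 <= pr (F k) by exact: pr_ge0.
  move: hl; rewrite pf pastE; nra.
have DH k : (k <= n)%N -> pr (D k) <= 2 * pr (D k `&` H).
  elim: k => [_|k IH kn].
    have := FH 0%N isT; rewrite (_ : F 0%N = D 0%N)//.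
    rewrite /F bigcup0// setD0; apply/seteqP; split=> w /=; first by exists 0%N.
    by move=> [i]; rewrite leqn0 => /eqP ->.
  have DE : D k.+1 `\` D k = F k.+1.
    apply/seteqP; split=> w /=.
      move=> [[i ik hi] nD]; split; last by move=> [j /= jk hj]; apply: nD; exists j.
      by move: ik; rewrite leq_eqVlt => /predU1P[<-//|ik]; case: nD; exists i.
    move=> [h1 h2]; split; first by exists k.+1.
    by move=> [j jk hj]; apply: h2; exists j.
  have DS : D k `<=` D k.+1 by move=> w [i ik hi]; exists i => //; exact: leqW.
  have e1 := pr_setID P (mD k.+1) (mD k).
  rewrite (setIidr DS) DE in e1.
  have e2 := pr_setID P (measurableI _ _ (mD k.+1) mH) (mD k).
  have e3 : D k.+1 `&` H `&` D k = D k `&` H by rewrite setIAC (setIidr DS).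
  have e4 : (D k.+1 `&` H) `\` D k = F k.+1 `&` H by rewrite -DE setIDAC setIDA.
  rewrite e3 e4 in e2.
  have := IH (ltnW kn); have := FH _ kn; lra.
apply: le_trans (DH n (leqnn _)) _; rewrite ler_pM2l//; apply: le_pr => //.
exact: measurableI.
Qed.

(** The bound is uniform over grids, hence passes to the limit of fine grids. *)
Lemma stay_below_level s u x : 0 <= s -> s < u -> 0 < x ->
  exists2 k, 0 < k & forall (n : nat) (t : nat -> R),
    (forall i, (i < n)%N -> t i <= t i.+1) -> t 0%N = s -> t n = u ->
    k <= pr [set w | forall i, (i <= n)%N -> W (t i) w - W (t 0%N) w < x].
Proof.
move=> s0 su x0; exists (1 - 2 * pr [set w | x <= W u w - W s w]).
  by have := incr_tail s0 su x0; lra.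
move=> n t tm ts tu; have := @levy_maximal t n x _ tm; rewrite ts tu => /(_ s0).
set E := [set w | exists2 i, _ & _].
have -> : [set w | forall i, (i <= n)%N -> W (t i) w - W s w < x] = ~` E.
  apply/seteqP; split=> w /=.
    by move=> h [i /h]; rewrite ltNge => /negP.
  by move=> h i ni; rewrite ltNge; apply/negP => hi; apply: h; exists i.
rewrite pr_setC; first lra.
rewrite (_ : E = \bigcup_(i in [set i | (i <= n)%N]) [set w | x <= W (t i) w - W s w]).
  by apply: bigcup_measurable => i _; exact: (incr_set _ _ (mge x)).
by apply/seteqP; split.
Qed.

End brownian_paths.

(** * Crossing an increasing barrier *)

Lemma ae_forall_countable d (T : measurableType d) (R : realType)
    (P : probability T R) (I : countType) (Q : I -> T -> Prop) :
  (forall i, {ae P, forall w, Q i w}) -> {ae P, forall w, forall i, Q i w}.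
Proof.
move=> aeQ.
have : {ae P, forall w, forall n : nat, if unpickle n is Some i then Q i w else True}.
  by apply: ae_foralln => n; case: unpickle => [i|]; [exact: aeQ|exact: aeW].
by apply: filterS => w h i; have := h (pickle i); rewrite pickleK.
Qed.

Lemma ae_False d (T : measurableType d) (R : realType) (P : probability T R) :
  {ae P, forall w, False} -> False.
Proof.
move=> [N [mN PN NT]]; have : (P setT = 0)%E.
  by apply/eqP; rewrite -measure_le0 -PN le_measure ?inE// => w _; exact: NT.
by rewrite probability_setT => /eqP; rewrite onee_eq0.
Qed.

Section barrier_crossing.
Context d (T : measurableType d) (R : realType) (P : probability T R).
Context (W : R -> T -> R) (hW : continuous_bm P W).
Local Notation pr := (Pr P).

Lemma cbm_near w t e : 0 < e ->
  exists2 r, 0 < r & forall s, `|s - t| < r -> `|W s w - W t w| < e.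
Proof.
move=> e0; have /cvgrPdist_lt/(_ _ e0)[r /= r0 h] := @cbm_continuous _ _ _ _ _ hW w t.
by exists r => // s st; rewrite distrC; apply: h; rewrite /= distrC.
Qed.

(** Around a touching time the supremum of [W - f] is nonnegative, because [f] is
   increasing and the path continuous; by [sup_dyadic_gap] it is not zero, for all
   intervals with rational ends at once. *)
Lemma touch_then_cross (f : R -> \bar R) : increasing_on_pos f ->
  {ae P, forall w, forall t, 0 < t -> (f t <= (W t w)%:E)%E ->
    forall u, t < u -> exists2 s, 0 < s < u & (f s < (W s w)%:E)%E}.
Proof.
move=> fi; pose Q (ab : rat * rat) w :=
  let a := ratr ab.1 : R in let b := ratr ab.2 : R in
  0 < a -> a < b ->
  (forall e, 0 < e -> exists m i, (i <= 2 ^ m)%N /\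
       (f (dyad a b m i) < (W (dyad a b m i) w + e)%:E)%E) ->
    exists m i, (i <= 2 ^ m)%N /\
       (f (dyad a b m i) < (W (dyad a b m i) w)%:E)%E.
have : {ae P, forall w, forall ab, Q ab w}.
  apply: ae_forall_countable => -[a b]; rewrite /Q/=.
  have [a0|na] := pselect (0 < ratr a :> R); last by apply: aeW.
  have [ab|nab] := pselect (ratr a < ratr b :> R); last by apply: aeW.
  by apply: filterS (sup_dyadic_gap hW f a0 ab) => w.
apply: filterS => w Qw t t0 ft u tu.
have [a] := rat_in_itvoo t0; rewrite in_itv/= => /andP[a0 at_].
have [b] := rat_in_itvoo tu; rewrite in_itv/= => /andP[tb bu].
have ab : ratr a < ratr b :> R by exact: lt_trans tb.
have [|m [i [im hi]]] := Qw (a, b) a0 ab; last first.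
  exists (dyad (ratr a) (ratr b) m i) => //; apply/andP; split.
    by apply: lt_le_trans a0 _; rewrite dyad_ge// ltW.
  by apply: le_lt_trans bu; rewrite dyad_le// ltW.
move=> e e0; have [r r0 hr] := cbm_near w t e0.
have [|m [i [im qt tq]]] := @dyad_dense R (ratr a) (ratr b) t r ab _ r0.
  by rewrite (ltW at_) (ltW tb).
exists m, i; split => //; set q := dyad _ _ _ _ in qt tq *.
have q0 : 0 < q by apply: lt_le_trans a0 _; rewrite dyad_ge// ltW.
apply: le_lt_trans (fi _ _ q0 qt) _; apply: le_lt_trans ft _; rewrite lte_fin.
have : `|W q w - W t w| < e by apply: hr; rewrite ltr_distl; lra.
by rewrite ltr_distl; lra.
Qed.

Let me_le (x : \bar R) r : measurable [set y : R | ((y + r)%:E <= x)%E].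
Proof.
rewrite -[X in measurable X]setTI; apply: emeasurable_fun_infty_c => //.
by apply/measurable_EFinP; exact: measurable_funD.
Qed.

(** Up to some small dyadic time the path has positive probability of being below
   the barrier and then at some distance [x] from it. Independently, the later
   increments stay below [x] with positive probability, and the barrier can only
   go up. *)
Lemma stay_below_barrier (f : R -> \bar R) t : increasing_on_pos f -> 0 < t ->
  {ae P, forall w, exists2 e, 0 < e & forall s, 0 < s < e -> ((W s w)%:E <= f s)%E} ->
  ~ {ae P, forall w, exists2 s, 0 < s <= t & (f s < (W s w)%:E)%E}.
Proof.
move=> fi t0 start cross.
pose q := dyad 0 t.
have q0 m i : (0 < i)%N -> 0 < q m i by move=> i0; exact: dyad_gt.
pose N m := [set w | forall i, (0 < i <= 2 ^ m)%N -> ((W (q m i) w)%:E <= f (q m i))%E].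
have mN m : measurable (N m).
  rewrite (_ : N m = \bigcap_(i in [set i | (0 < i <= 2 ^ m)%N])
     [set w | [set y | ((y + 0)%:E <= f (q m i))%E] (W (q m i) w)]); last first.
    by apply/seteqP; split=> w /= h i im; have := h i im; rewrite /= addr0.
  by apply: bigcap_measurableType => i _; exact: (cbm_value_measurable hW).
have NS m : N m.+1 `<=` N m.
  move=> w h i /andP[i0 im]; have := h (2 * i)%N.
  by rewrite muln_gt0 i0/= expnS leq_mul2l im => /(_ isT); rewrite /q dyad_double.
(* by continuity a strict crossing occurs already at a slightly earlier dyadic time *)
have N0 : pr (\bigcap_m N m) = 0.
  apply/ae_pr0P; first exact: bigcap_measurableType.
  apply: filterS cross => w [s /andP[s0 st] fs] Nw.
  have [e e0 he] : exists2 e, 0 < e & (f s <= (W s w - e)%:E)%E.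
    case: (f s) fs => [x|//|] fx; last by exists 1; rewrite ?leNye.
    by rewrite lte_fin in fx; exists (W s w - x); [lra|rewrite lee_fin; lra].
  have [r r0 hr] := cbm_near w s e0.
  pose r' := Num.min r s; have r'0 : 0 < r' by rewrite lt_min r0.
  have [|m [i [im qs sq]]] := @dyad_dense R 0 t s r' t0 _ r'0.
    by rewrite (ltW s0).
  have sr : r' <= r /\ r' <= s by rewrite !ge_min !lexx orbT.
  have i0 : (0 < i)%N.
    by rewrite lt0n; apply/eqP => i0; move: sq; rewrite i0 dyad0; lra.
  rewrite -/(q m i) in qs sq.
  have := Nw m I i; rewrite i0 im => /(_ isT); apply/negP; rewrite -ltNge.
  apply: le_lt_trans (fi _ _ (q0 _ _ i0) qs) _; apply: le_lt_trans he _.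
  rewrite lte_fin; have : `|W (q m i) w - W s w| < e by apply: hr; rewrite ltr_distl; lra.
  by rewrite ltr_distl; lra.
(* being below on the dyadic grid up to time [t / 2 ^ k] *)
pose H k w := forall m i, (0 < i)%N -> (i * 2 ^ k <= 2 ^ m)%N ->
   ((W (q m i) w)%:E <= f (q m i))%E.
have mH k : measurable [set w | H k w].
  rewrite (_ : [set w | _] = \bigcap_m \bigcap_(i in [set i | (0 < i)%N /\ (i * 2 ^ k <= 2 ^ m)%N])
    [set w | [set y | ((y + 0)%:E <= f (q m i))%E] (W (q m i) w)]).
    do 2 apply: bigcap_measurableType => ? _; exact: (cbm_value_measurable hW).
  apply/seteqP; split=> w /= h m.
    by move=> _ i [i0 im] /=; rewrite addr0; exact: h.
  by move=> i i0 im; have := h m I i (conj i0 im); rewrite /= addr0.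
pose E k n := [set w | H k w] `&`
  [set w | [set y | ((y + n.+1%:R^-1)%:E <= f (q k 1%N))%E] (W (q k 1%N) w)].
have mE k n : measurable (E k n).
  by apply: measurableI; [exact: mH|exact: (cbm_value_measurable hW)].
have [k [n [k0 pE]]] : exists k n, (0 < k)%N /\ 0 < pr (E k n).
  apply: contrapT => nE.
  have {}nE k n : (0 < k)%N -> {ae P, forall w, ~ E k n w}.
    move=> k0; apply/ae_pr0P => //; apply/eqP; rewrite eq_le pr_ge0 andbT leNgt.
    by apply/negP => h; apply: nE; exists k, n.
  have atom k : {ae P, forall w, (W (q k 1%N) w)%:E <> f (q k 1%N)}.
    case: (f _) => [x| |]; [|exact: aeW|exact: aeW].
    have := no_atom hW x (q0 k 1%N isT).
    move=> /(ae_pr0P _ (cbm_value_measurable hW (q k 1%N) (measurable_set1 x))).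
    by apply: filterS => w /= h [].
  have ae1 : {ae P, forall w, forall kn : nat * nat, (0 < kn.1)%N -> ~ E kn.1 kn.2 w}.
    apply: ae_forall_countable => -[k n] /=.
    have [k0|k0] := boolP (0 < k)%N; last exact: aeW.
    by apply: filterS (nE k n k0) => w.
  apply: (@ae_False _ _ _ P).
  apply: filterS3 start ae1 (ae_foralln atom) => w [e e0 he] nEw nat_.
  pose k := (Num.bound (t / e)).+1.
  have ke : t < 2 ^+ k * e.
    rewrite -ltr_pdivrMr//; apply: lt_trans (archi_boundP _) _; first by rewrite divr_ge0// ltW.
    by rewrite -natrX ltr_nat; apply: ltn_trans (ltnSn _) _; exact: ltn_expl.
  have Hk : H k w.
    move=> m i i0 im; apply: he; rewrite q0//= /q /dyad add0r subr0.
    rewrite mulrA ltr_pdivrMr ?exprn_gt0//.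
    have : i%:R * 2 ^+ k <= 2 ^+ m :> R by rewrite -!natrX -natrM ler_nat.
    have : 0 < i%:R :> R by rewrite ltr0n.
    nra.
  have Wk : ((W (q k 1%N) w)%:E < f (q k 1%N))%E.
    rewrite lt_neqAle; apply/andP; split; first exact/eqP/nat_.
    by apply: Hk => //; rewrite mul1n.
  have [n hn] : exists n, ((W (q k 1%N) w + n.+1%:R^-1)%:E <= f (q k 1%N))%E.
    case: (f _) Wk => [x| |//] Wx; last by exists 0%N; rewrite leey.
    rewrite lte_fin -subr_gt0 in Wx; exists (Num.bound (x - W (q k 1%N) w)^-1).
    rewrite lee_fin -lerBrDl invf_ple ?posrE ?ltr0n//.
    apply: ltW; apply: lt_le_trans (archi_boundP _) _; first by rewrite invr_ge0 ltW.
    by rewrite ler_nat.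
  exact: (nEw (k, n) isT).
pose x : R := n.+1%:R^-1.
have x0 : 0 < x by rewrite invr_gt0 ltr0n.
have d0 : 0 < q k 1%N by exact: q0.
have dt : q k 1%N < t.
  rewrite /q /dyad add0r subr0 mul1r -[ltRHS]mulr1 ltr_pM2l// invf_lt1 ?exprn_gt0//.
  by rewrite exprn_egt1 ?ltr1n //; case: (k) k0.
have [c c0 hc] := stay_below_level hW (ltW d0) dt x0.
have key m : (k <= m)%N -> pr (E k n) * c <= pr (N m).
  move=> km; pose k' := (2 ^ (m - k))%N.
  have k'm : (k' <= 2 ^ m)%N by rewrite leq_exp2l// leq_subr.
  have qk' : q m k' = q k 1%N.
    by rewrite /q -(dyad_shift 0 t k (m - k) 1) subnKC// muln1.
  have qm i : (i < 2 ^ m)%N -> q m i <= q m i.+1 by move=> _; exact/le_dyad/leqnSn/ltW.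
  pose A j := if j == k' then [set y | ((y + x)%:E <= f (q k 1%N))%E] else
     if j == 0%N then setT else [set y | ((y + 0)%:E <= f (q m j))%E].
  have mA j : measurable (A j) by do 2 apply: if_measurable => //; exact: me_le.
  have [mp mf pf] := @past_future_indep _ _ _ _ _ hW (2 ^ m) k' (q m) A
    (fun=> [set y | y < x]) k'm (dyad_ge _ _ (ltW t0)) qm mA
    (fun=> (ltac:(by rewrite -set_itvNyo) : measurable [set y : R | y < x])).
  set past := [set w | _] in mp pf; set fut := [set w | _] in mf pf.
  have Ep : E k n `<=` past.
    move=> w [Hw Ew] j jk'; rewrite {2}/q dyad0 (cbm_start hW) subr0 /A.
    case: eqP => [->|_]; first by rewrite qk'.
    case: posnP => [//|j0] /=; rewrite addr0; apply: Hw => //.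
    by rewrite -(subnK km) expnD leq_mul2r; apply/orP; right.
  have fc : c <= pr fut.
    rewrite (_ : fut = [set w | forall i, (i <= 2 ^ m - k')%N ->
        W (q m (k' + i)%N) w - W (q m (k' + 0)%N) w < x]).
      apply: (hc (2 ^ m - k')%N (fun i => q m (k' + i)%N)).
      - by move=> i ik; rewrite addnS; apply: qm; lia.
      - by rewrite addn0.
      - by rewrite subnKC// /q dyad_max.
    apply/seteqP; split=> w /= h i; rewrite ?addn0.
      by move=> ik; apply: h; lia.
    move=> /andP[ki im]; have := h (i - k')%N; rewrite subnKC// addn0; apply.
    by rewrite leq_sub2r.
  apply: (@le_trans _ _ (pr (past `&` fut))).
    by rewrite pf ler_pM ?pr_ge0 ?(ltW c0)// le_pr.
  apply: le_pr => //; first exact: measurableI.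
  move=> w [wp wf] i /andP[i0 im].
  have W0 : W (q m 0%N) w = 0 by rewrite /q dyad0 (cbm_start hW).
  have wk' : ((W (q k 1%N) w + x)%:E <= f (q k 1%N))%E.
    by have := wp k' (leqnn _); rewrite W0 subr0 /A eqxx qk'.
  have [ik'|k'i] := ltnP i k'.
    have := wp i (ltnW ik'); rewrite W0 subr0 /A ltn_eqF// gtn_eqF//=.
    by rewrite addr0.
  apply: le_trans (fi _ _ d0 _); last first.
    by rewrite -qk'; apply: le_dyad => //; exact: ltW.
  apply: le_trans wk'; rewrite lee_fin.
  have := wf i; rewrite k'i im qk' /= => /(_ isT); lra.
have [M /(_ (maxn M k)) h] := pr_nonincreasing P mN NS (mulr_gt0 pE c0).
have := h (leq_maxl _ _); rewrite N0 add0r => h1.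
by have := key (maxn M k) (leq_maxr _ _); rewrite leNgt h1.
Qed.

End barrier_crossing.

(** * Prescribing the law of the first alarm *)

Section cutoffs.
Context d (T : measurableType d) (R : realType) (P : probability T R).
Local Notation pr := (Pr P).

Lemma atomless_near (Y : T -> R) (x e : R) : measurable_fun setT Y ->
  pr [set w | Y w = x] = 0 -> 0 < e ->
  exists2 r, 0 < r & pr [set w | x - r < Y w <= x + r] < e.
Proof.
move=> mY Yx e0.
have mA a b : measurable [set w | a < Y w <= b].
  rewrite -[X in measurable X]setTI.
  have := mY measurableT _ (measurable_itv `]a, b]).
  by congr (measurable (_ `&` _)); apply/seteqP; split=> w /=; rewrite in_itv.
have mx : measurable [set w | Y w = x].
  by rewrite -[X in measurable X]setTI; exact: (mY measurableT _ (measurable_set1 x)).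
have [n w /=|n /(_ n (leqnn _)) h] := pr_nonincreasing P
    (fun n => mA (x - n.+1%:R^-1) (x + n.+1%:R^-1)) _ e0.
  have le : n.+2%:R^-1 <= n.+1%:R^-1 :> R by rewrite lef_pV2 ?posrE ?ltr0n// ler_nat.
  move=> /andP[h1 h2]; apply/andP; split.
    by apply: le_lt_trans h1; rewrite lerD2l lerN2.
  by apply: le_trans h2 _; rewrite lerD2l.
exists n.+1%:R^-1; first by rewrite invr_gt0 ltr0n.
apply: lt_le_trans h _; rewrite -lerBrDr subrr -Yx; apply: le_pr => //.
  exact: bigcap_measurableType.
move=> w /= h; apply/eqP; rewrite eq_le; apply/andP; split.
  apply/ler_addgt0Pr => r r0; have := h (Num.bound r^-1) I => /=.
  suff : (Num.bound r^-1).+1%:R^-1 <= r by set z := _^-1; lra.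
  rewrite invf_ple ?posrE ?ltr0n//; apply: ltW.
  apply: lt_le_trans (archi_boundP _) _; first by rewrite invr_ge0 ltW.
  by rewrite ler_nat.
apply/ler_addgt0Pr => r r0; have := h (Num.bound r^-1) I => /=.
suff : (Num.bound r^-1).+1%:R^-1 <= r by set z := _^-1; lra.
rewrite invf_ple ?posrE ?ltr0n//; apply: ltW.
apply: lt_le_trans (archi_boundP _) _; first by rewrite invr_ge0 ltW.
by rewrite ler_nat.
Qed.

Context (I : finType) (Y : I -> T -> R).

(** Ties put an outcome in several of these events; passage times of distinct
   levels have almost surely none. *)
Definition first_alarm (t : I -> R) (i : I) : set T :=
  [set w | Y i w <= t i /\ forall j, Y j w <= t j -> Y i w <= Y j w].

Hypothesis mY : forall i, measurable_fun setT (Y i).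

Lemma first_alarm_measurable t i : measurable (first_alarm t i).
Proof.
have mle (f g : T -> R) : measurable_fun setT f -> measurable_fun setT g ->
    measurable [set w | f w <= g w].
  move=> mf mg; rewrite -[X in measurable X]setTI.
  exact: (@measurable_fun_le _ _ _ setT f g measurableT mf mg).
have mlt (f g : T -> R) : measurable_fun setT f -> measurable_fun setT g ->
    measurable [set w | f w < g w].
  move=> mf mg; rewrite (_ : [set w | _] = ~` [set w | g w <= f w]).
    by apply: measurableC; exact: mle.
  by apply/seteqP; split=> w /=; rewrite ltNge => /negP.
rewrite (_ : first_alarm t i = [set w | Y i w <= t i] `&`
  \bigcap_(j in [set: I]) ([set w | t j < Y j w] `|` [set w | Y i w <= Y j w])).
  apply: measurableI; first exact: mle.
  apply: fin_bigcap_measurable => // j _; apply: measurableU; [exact: mlt|exact: mle].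
apply/seteqP; split=> w [h1 h2]; split=> //.
  by move=> j _ /=; have [h|h] := ltP (t j) (Y j w); [left|right; exact: h2].
by move=> j hj; have := h2 j Logic.I; case=> //=; rewrite ltNge hj.
Qed.

Hypothesis Y0 : forall i w, 0 < Y i w.
Hypothesis Y1 : forall i w, Y i w <= 1.
Hypothesis Ya : forall i x, pr [set w | Y i w = x] = 0.

(** Raising the cutoff of [i] can only make the other alarms less likely
   to be first; so the coordinatewise supremum of all cutoffs for which no alarm
   exceeds its quota again respects the quotas, and maximality forces equality. *)
Lemma cutoffs_exist (p : I -> R) : (forall i, 0 <= p i) -> \sum_i p i = 1 ->
  exists t : I -> R, forall i, pr (first_alarm t i) = p i.
Proof.
move=> p0 p1; pose E := first_alarm.
have mE t i : measurable (E t i) by exact: first_alarm_measurable.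
pose S := [set t : I -> R | forall i, 0 <= t i <= 1 /\ pr (E t i) <= p i].
have S0 : S (fun=> 0).
  move=> i; rewrite lexx ler01; split=> //.
  rewrite (_ : E _ i = set0) ?pr0//; apply/seteqP; split=> // w [/= h _].
  by have := Y0 i w; rewrite ltNge h.
pose s i := sup [set t i | t in S].
have hS i : has_sup [set t i | t in S].
  by split; [exists 0, (fun=> 0)|exists 1 => _ [t St <-]; have [/andP[]] := St i].
have sS t i : S t -> t i <= s i by move=> St; apply: ub_le_sup; [case: (hS i)|exists t].
have s01 i : 0 <= s i <= 1.
  rewrite (sS _ _ S0)/=; apply: ge_sup; first by case: (hS i).
  by move=> _ [t St <-]; have [/andP[]] := St i.
have mB i a b : measurable [set w | a < Y i w <= b].
  rewrite -[X in measurable X]setTI.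
  have /(_ measurableT _ (measurable_itv `]a, b])) := mY i.
  by congr (measurable (_ `&` _)); apply/seteqP; split=> w /=; rewrite in_itv.
have Es i : pr (E s i) <= p i.
  apply/ler_addgt0Pr => e e0.
  have [r r0 hr] := atomless_near (mY i) (Ya i (s i)) e0.
  have [_ [t St <-] ht] := sup_adherent r0 (hS i); rewrite -/(s i) in ht.
  have h1 : pr (E s i) <= pr (E t i `|` [set w | s i - r < Y i w <= s i + r]).
    apply: le_pr => //; first exact: measurableU.
    move=> w [h1 h2]; have [h|h] := ltP (s i - r) (Y i w).
      by right; rewrite /= h/= (le_trans h1)// lerDl ltW.
    left; split; first by apply: ltW; exact: le_lt_trans ht.
    by move=> j hj; apply: h2; apply: le_trans hj _; exact: sS.
  have h2 := pr_setU_le P (mE t i) (mB i (s i - r) (s i + r)).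
  have [_ h3] := St i; lra.
exists s => i; apply/eqP; rewrite eq_le Es leNgt; apply/negP => hi.
have [s1|s1] := eqVneq (s i) 1.
  have cover : 1 <= \sum_j pr (E s j).
    apply: le_trans (pr_bigcup_le P _ (mE s)).
    rewrite (_ : \big[_/_]_(_ <- _) _ = setT) ?prT//.
    apply/seteqP; split=> // w _; rewrite -bigcup_seq.
    have := @arg_minP _ _ I i (fun j => Y j w <= s j) (fun j => Y j w).
    rewrite s1 => /(_ (Y1 i w)) [j hj hmin].
    by exists j => //=; rewrite mem_index_enum.
  have : 0 < \sum_j (p j - pr (E s j)).
    rewrite (bigD1 i)//= ltr_wpDr ?subr_gt0// sumr_ge0// => j _.
    by rewrite subr_ge0.
  by rewrite sumrB p1 subr_gt0 ltNge cover.
have e0 : 0 < p i - pr (E s i) by rewrite subr_gt0.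
have si1 : s i < 1 by rewrite lt_neqAle s1; case/andP: (s01 i).
have [r r0 hr] := atomless_near (mY i) (Ya i (s i)) e0.
pose r' := Num.min r (1 - s i).
have r'0 : 0 < r' by rewrite lt_min r0 subr_gt0.
have [r'r r'1] : r' <= r /\ r' <= 1 - s i by rewrite !ge_min !lexx orbT.
(* raise the single cutoff [i] by less than the missing mass allows *)
pose t j := if j == i then s i + r' else s j.
suff : S t by move=> /(sS _ i); rewrite /t eqxx; lra.
have st j : s j <= t j by rewrite /t; case: eqP => [->|_//]; rewrite lerDl ltW.
move=> j; split.
  by have := s01 j; have := s01 i; rewrite /t; case: ifP; lra.
have [->|ji] := eqVneq j i; last first.
  apply: le_trans (Es j); apply: le_pr => // w [h1 h2]; split.
    by move: h1; rewrite /t (negbTE ji).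
  by move=> k hk; apply: h2; exact: le_trans (st k).
have h1 : pr (E t i) <= pr (E s i `|` [set w | s i - r < Y i w <= s i + r]).
  apply: le_pr => //; first exact: measurableU.
  move=> w []; rewrite {1}/t eqxx => h1 h2; have [h|h] := ltP (s i) (Y i w).
    by right => /=; lra.
  by left; split => // k hk; apply: h2; exact: le_trans (st k).
have h2 := pr_setU_le P (mE s i) (mB i (s i - r) (s i + r)).
lra.
Qed.

End cutoffs.

(** * Measurability of first times and stopped values *)

Section measurability.
Context d (T : measurableType d) (R : realType).

Lemma measurable_fun_lt_erealP (f : T -> \bar R) :
  (forall r : R, measurable [set w | (f w < r%:E)%E]) -> measurable_fun setT f.
Proof.
move=> h mD; apply: (measurability _ (ErealGenInftyO.measurableE R)) => //.
move=> _ [_ [r ->] <-]; rewrite setTI (_ : _ @^-1` _ = [set w | (f w < r%:E)%E]).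
  exact: h.
by apply/seteqP; split=> w /=; rewrite in_itv.
Qed.

Lemma measurable_contract (f : T -> \bar R) :
  measurable_fun setT f -> measurable_fun setT (fun w => contract (f w)).
Proof.
move=> mf mD; apply: (measurability _ (RGenInftyO.measurableE R)) => //.
move=> _ [_ [r ->] <-].
rewrite setTI (_ : _ @^-1` _ = [set w | contract (f w) < r]); last first.
  by apply/seteqP; split=> w /=; rewrite in_itv.
have [r1|r1] := ltP 1 r.
  rewrite (_ : [set w | _] = setT)//; apply/seteqP; split=> // w _ /=.
  by apply: le_lt_trans r1; apply: le_trans (ler_norm _) (contract_le1 _).
have [rm|rm] := ltP r (-1).
  rewrite (_ : [set w | _] = set0)//; apply/seteqP; split=> // w /= h.
  have := contract_le1 (f w); rewrite ler_norml => /andP[h1 _].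
  by have := lt_trans h rm; rewrite ltNge h1.
rewrite -(expandK (_ : r \in [pred r | `|r| <= 1])); last first.
  by rewrite inE ler_norml rm.
rewrite (_ : [set w | _] = setT `&` [set w | (f w < expand r)%E]); last first.
  by rewrite setTI; apply/seteqP; split=> w /=; rewrite lt_contract.
exact: emeasurable_fun_infty_o.
Qed.

(** The second hypothesis reduces the infimum over all times to rational times. *)
Lemma first_time_measurable (E : R -> T -> Prop) :
  (forall t, 0 < t -> measurable [set w | E t w]) ->
  (forall w t, 0 < t -> E t w ->
     exists2 r, 0 < r & forall s, 0 < s -> t - r < s <= t -> E s w) ->
  measurable_fun setT (first_time E).
Proof.
move=> mE lE; apply: measurable_fun_lt_erealP => u.
pose F (q : rat) := [set w | (0 < ratr q :> R) && (ratr q < u) /\ E (ratr q) w].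
have -> : [set w | (first_time E w < u%:E)%E] = \bigcup_q F q; last first.
  apply: bigcupT_measurable_rat => q; rewrite /F.
  have [/andP[q0 qu]|nq] := boolP ((0 < ratr q :> R) && (ratr q < u)).
    rewrite (_ : [set w | _] = [set w | E (ratr q) w]); first exact: mE.
    by apply/seteqP; split=> w /= => [[]|].
  by rewrite (_ : [set w | _] = set0)//; apply/seteqP; split=> // w [].
apply/seteqP; split=> w /=.
  move=> /ereal_inf_lt[_ [t [t0 Et] <-]]; rewrite lte_fin => tu.
  have [r r0 hr] := lE w t t0 Et.
  have : Num.max 0 (t - r) < t by rewrite gt_max t0; lra.
  move=> /rat_in_itvoo[q]; rewrite in_itv/= gt_max => /andP[/andP[q0 rq] qt].
  exists q => //; split; first by rewrite q0; exact: lt_trans tu.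
  by apply: hr => //; rewrite rq ltW.
move=> [q _ [/andP[q0 qu] Eq]]; apply: (@le_lt_trans _ _ (ratr q)%:E).
  by apply: ereal_inf_lbound; exists (ratr q).
by rewrite lte_fin.
Qed.

(** Along the dyadic approximations of [tau] from the right, the stopped value is a
   countable gluing of the variables [W t]. *)
Lemma stopped_value_measurable (W : R -> T -> R) (tau : T -> R) :
  (forall t, measurable_fun setT (W t)) -> (forall w, continuous (W^~ w)) ->
  measurable_fun setT tau -> (forall w, 0 <= tau w) ->
  measurable_fun setT (fun w => W (tau w) w).
Proof.
move=> mW cW mt t0.
pose k n w := Num.truncn (tau w * 2 ^+ n).
apply: (@measurable_fun_cvg _ _ _ _ (fun n w => W ((k n w).+1%:R / 2 ^+ n) w)) => //.
  move=> n _ A mA; rewrite setTI.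
  rewrite (_ : _ @^-1` A = \bigcup_i
     ([set w | tau w \in `[i%:R / 2 ^+ n, i.+1%:R / 2 ^+ n[] `&`
      [set w | A (W (i.+1%:R / 2 ^+ n) w)])).
    apply: bigcup_measurable => i _; apply: measurableI.
      rewrite -[X in measurable X]setTI.
      exact: (mt measurableT _ (measurable_itv `[i%:R / 2 ^+ n, i.+1%:R / 2 ^+ n[)).
    by rewrite -[X in measurable X]setTI; exact: mW.
  have p0 : 0 < 2 ^+ n :> R by rewrite exprn_gt0.
  have kE w : (k n w)%:R <= tau w * 2 ^+ n < (k n w).+1%:R.
    by apply: truncn_itv; rewrite mulr_ge0 ?t0// ltW.
  apply/seteqP; split=> w /=.
    move=> Aw; exists (k n w) => //; split => //=.
    by rewrite in_itv/= ler_pdivrMr// ltr_pdivlMr.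
  move=> [i _ [/=]]; rewrite in_itv/= ler_pdivrMr// ltr_pdivlMr// => /truncn_def hi.
  by rewrite /k hi.
move=> w _.
apply: (@cvg_comp _ _ _ (fun n => (k n w).+1%:R / 2 ^+ n : R) (W^~ w) _ (nbhs (tau w))); last exact: cW.
apply/cvgrPdist_lt => e e0.
exists (Num.bound e^-1) => // n /= en.
have p0 : 0 < 2 ^+ n :> R by rewrite exprn_gt0.
have kE : (k n w)%:R <= tau w * 2 ^+ n < (k n w).+1%:R.
  by apply: truncn_itv; rewrite mulr_ge0 ?t0// ltW.
have pe : 1 < e * 2 ^+ n.
  rewrite mulrC -ltr_pdivrMr// mul1r; apply: lt_le_trans (archi_boundP _) _.
    by rewrite invr_ge0 ltW.
  rewrite -natrX ler_nat; apply: leq_trans en _; exact/ltnW/ltn_expl.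
have /andP[k1 k2] := kE.
have h1 : tau w < (k n w).+1%:R / 2 ^+ n by rewrite ltr_pdivlMr.
have h2 : (k n w).+1%:R / 2 ^+ n < tau w + e.
  by rewrite ltr_pdivrMr// mulrDl -natr1; lra.
by rewrite ltr_distl; lra.
Qed.

End measurability.

(** * Embedding laws with finitely many atoms *)

Lemma pr_bigcup_disj d (T : measurableType d) (R : realType)
    (P : probability T R) (I : choiceType) (s : seq I) (F : I -> set T) :
  (forall i, measurable (F i)) -> uniq s ->
  (forall i j w, F i w -> F j w -> i = j) ->
  Pr P (\big[setU/set0]_(i <- s) F i) = \sum_(i <- s) Pr P (F i).
Proof.
move=> mF + dF; elim: s => [|i s IH]; first by rewrite !big_nil pr0.
move=> /= /andP[is_ us]; rewrite !big_cons -IH// pr_setU_disj//.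
  exact: bigsetU_measurable.
apply/seteqP; split=> // w [Fi]; rewrite -bigcup_seq => -[j /= js Fj].
by move: is_; rewrite (dF _ _ _ Fi Fj) js.
Qed.

Section discrete_embedding.
Context d (T : measurableType d) (R : realType) (P : probability T R).
Context (W : R -> T -> R) (hW : continuous_bm P W).
Local Notation pr := (Pr P).

(** First passage strictly beyond the level [x], on the side away from [0]. *)
Definition passage (x : R) : T -> \bar R :=
  first_time (fun t w => x ^+ 2 < x * W t w).

Lemma passage_le x w s : 0 < s -> x ^+ 2 < x * W s w -> (passage x w <= s%:E)%E.
Proof. by move=> s0 h; apply: ereal_inf_lbound; exists s. Qed.

Let beyond_left x w t : 0 < t -> x ^+ 2 < x * W t w ->
  exists2 r, 0 < r & forall s, `|s - t| < r -> x ^+ 2 < x * W s w.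
Proof.
move=> t0 h; have x0 : 0 < `|x| + 1 by have := normr_ge0 x; lra.
have e0 : 0 < (x * W t w - x ^+ 2) / (`|x| + 1) by rewrite divr_gt0 ?subr_gt0.
have [r r0 hr] := cbm_near hW w t e0; exists r => // s /hr.
rewrite ltr_pdivlMr// => hs.
have : `|x * (W s w - W t w)| < x * W t w - x ^+ 2.
  rewrite normrM; apply: le_lt_trans hs; rewrite mulrC ler_wpM2l// lerDl//.
by rewrite ltr_norml => /andP[+ _]; rewrite mulrBr; lra.
Qed.

Lemma passage_measurable x : measurable_fun setT (passage x).
Proof.
apply: first_time_measurable => [t t0|w t t0 h].
  apply: (@cbm_value_measurable _ _ _ _ _ hW t [set y | x ^+ 2 < x * y]).
  have /(_ measurableT _ (measurable_itv `]x ^+ 2, +oo[)) :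
    measurable_fun setT (fun y : R => x * y) by exact: measurable_funM.
  by rewrite preimage_itvoy setTI.
have [r r0 hr] := beyond_left t0 h; exists r => // s _ hs; apply: hr.
by rewrite ltr_distl; lra.
Qed.

Lemma passage_gt0 x w : x != 0 -> (0 < passage x w)%E.
Proof.
move=> x0; have e0 : 0 < `|x| by rewrite normr_gt0.
have [r r0 hr] := cbm_near hW w 0 e0.
apply: (@lt_le_trans _ _ r%:E); first by rewrite lte_fin.
apply: le_ereal_inf_tmp => _ [t [t0 ht] <-]; rewrite lee_fin leNgt; apply/negP => tr.
have := hr t; rewrite subr0 gtr0_norm// => /(_ tr); rewrite (cbm_start hW) subr0 => h.
have : x ^+ 2 < x ^+ 2.
  apply: lt_trans ht _; apply: le_lt_trans (ler_norm _) _.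
  by rewrite normrM -[ltRHS]real_normK ?num_real// expr2 ltr_pM2l.
by rewrite ltxx.
Qed.

Lemma passage_value x w s : x != 0 -> passage x w = s%:E -> W s w = x.
Proof.
move=> x0 es; have s0 : 0 < s by rewrite -lte_fin -es passage_gt0.
have le : x * W s w <= x ^+ 2.
  rewrite leNgt; apply/negP => h; have [r r0 hr] := beyond_left s0 h.
  pose u := s - Num.min r s / 2.
  have m0 : 0 < Num.min r s by rewrite lt_min r0.
  have [mr ms] : Num.min r s <= r /\ Num.min r s <= s by rewrite !ge_min !lexx orbT.
  have : (passage x w <= u%:E)%E.
    by apply: passage_le; [rewrite /u; lra|apply: hr; rewrite ltr_distl /u; lra].
  by rewrite es lee_fin /u; lra.
have ge : x ^+ 2 <= x * W s w.
  apply/ler_addgt0Pr => e e0; have x1 : 0 < `|x| + 1 by have := normr_ge0 x; lra.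
  have e1 : 0 < e / (`|x| + 1) by rewrite divr_gt0.
  have [r r0 hr] := cbm_near hW w s e1.
  have : (passage x w < (s + r)%:E)%E by rewrite es lte_fin; lra.
  move=> /ereal_inf_lt[_ [t [t0 ht] <-]]; rewrite lte_fin => tr.
  have st : s <= t by rewrite -lee_fin -es passage_le.
  have /hr : `|t - s| < r by rewrite ltr_distl; lra.
  rewrite ltr_pdivlMr// => hs.
  have : `|x * (W t w - W s w)| < e.
    rewrite normrM; apply: le_lt_trans hs; rewrite mulrC ler_wpM2l// lerDl//.
  by rewrite ltr_norml mulrBr => /andP[_]; lra.
by apply: (mulfI x0); rewrite -expr2; apply/eqP; rewrite eq_le le.
Qed.

Lemma passage_lty x : x != 0 -> {ae P, forall w, (passage x w < +oo)%E}.
Proof.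
move=> x0; have xx : 0 < x ^+ 2 by rewrite exprn_even_gt0.
have [xp|xn] := ltP 0 x.
  apply: filterS (cbm_unbounded hW) => w /(_ x)[t t0 ht].
  apply: le_lt_trans (ltry t); apply: passage_le => //.
  by rewrite expr2 ltr_pM2l.
have {}xn : x < 0 by rewrite lt_neqAle x0.
apply: filterS (cbm_unbounded (continuous_bm_opp hW)) => w /(_ (- x))[t t0 ht].
apply: le_lt_trans (ltry t); apply: passage_le => //.
by rewrite expr2 ltr_nM2l//; lra.
Qed.

Context (I : finType) (x : I -> R) (p : I -> R).
Hypothesis x_inj : injective x.
Hypothesis x_neq0 : forall i, x i != 0.
Hypothesis p_ge0 : forall i, 0 <= p i.
Hypothesis p_sum : \sum_i p i = 1.

(** The alarms are the first passages at the levels [x i], with times compressed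
   to [[0, 1]] by [contract], and the cutoffs are those of [cutoffs_exist]. The
   upper barrier is the lowest positive level that is still active, which makes
   it increasing whatever the cutoffs are; by continuity of the path, being beyond
   it means having passed an active level before. *)
Lemma discrete_embedding :
  exists (b c : R -> \bar R) (tau : T -> \bar R) (X : T -> R),
    [/\ [/\ {homo b : s t / s <= t >-> (s <= t)%E},
            {homo c : s t / s <= t >-> (t <= s)%E},
            forall t, (0 <= b t)%E & forall t, (c t <= 0)%E],
        [/\ measurable_fun setT tau, forall w, (0 <= tau w)%E & measurable_fun setT X],
        forall w s, tau w = s%:E ->
          [/\ 0 < s, X w = W s w & (b s <= (X w)%:E \/ (X w)%:E <= c s)%E],
        forall w s, 0 < s -> (b s < (W s w)%:E \/ (W s w)%:E < c s)%E ->
          (tau w <= s%:E)%E &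
        {ae P, forall w, (tau w < +oo)%E} /\
        forall A : set R, measurable A ->
          pr (X @^-1` A) = \sum_(i | x i \in A) p i].
Proof.
pose Y i w := contract (passage (x i) w).
have mY i : measurable_fun setT (Y i).
  by apply: measurable_contract; exact: passage_measurable.
have Y0 i w : 0 < Y i w.
  by rewrite -(@contract0 R) /Y lt_contract; exact: passage_gt0.
have Y1 i w : Y i w <= 1 by apply: le_trans (ler_norm _) (contract_le1 _).
have Ylt i : {ae P, forall w, Y i w < 1}.
  apply: filterS (passage_lty (x_neq0 i)) => w h.
  by rewrite lt_neqAle Y1 andbT /Y contract_eq1 lt_eqF.
have mYx i a : measurable [set w | Y i w = a].
  by rewrite -[X in measurable X]setTI; exact: (mY i measurableT _ (measurable_set1 a)).
have Ya i a : pr [set w | Y i w = a] = 0.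
  have [->|a1] := eqVneq a 1.
    by apply/ae_pr0P => //; apply: filterS (Ylt i) => w h /= h1; move: h; rewrite h1 ltxx.
  have [[w0 /= w0a]|ne] := pselect (exists w, Y i w = a); last first.
    rewrite (_ : [set w | _] = set0) ?pr0//; apply/seteqP; split=> // w /= h.
    by apply: ne; exists w.
  have : (0 < passage (x i) w0)%E by exact: passage_gt0.
  case e: (passage (x i) w0) => [s| |//]; last first.
    by move=> _; move: a1; rewrite -w0a /Y e; have /eqP -> := contract_eq1 (+oo%E : \bar R); rewrite eqxx.
  rewrite lte_fin => s0; apply/eqP; rewrite eq_le pr_ge0 andbT -(no_atom hW (x i) s0).
  apply: le_pr => //; first exact: (cbm_value_measurable hW s (measurable_set1 (x i))).
  move=> w /= h; apply: passage_value => //; rewrite -e; apply: contract_inj.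
  by rewrite -[LHS]/(Y i w) h -w0a.
have [cut hcut] := cutoffs_exist mY Y0 Y1 Ya p_ge0 p_sum.
pose b (t : R) := ereal_inf [set (x i)%:E | i in [set i | 0 < x i /\ contract t%:E <= cut i]].
pose c (t : R) := ereal_sup [set (x i)%:E | i in [set i | x i < 0 /\ contract t%:E <= cut i]].
pose tau w := ereal_inf [set passage (x i) w | i in [set i | Y i w <= cut i]].
have tau_first i w : first_alarm Y cut i w -> tau w = passage (x i) w.
  move=> [h1 h2]; apply/eqP; rewrite eq_le; apply/andP; split.
    by apply: ereal_inf_lbound; exists i.
  by apply: le_ereal_inf_tmp => _ [j /h2 hj <-]; rewrite -le_contract.
have first_ex i w : Y i w <= cut i -> exists j, first_alarm Y cut j w.
  move=> hi; have [j hj hmin] := arg_minP (P := fun j => Y j w <= cut j) (fun j => Y j w) hi.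
  by exists j; split.
have mtau : measurable_fun setT tau.
  apply: measurable_fun_lt_erealP => u.
  rewrite (_ : [set w | _] = \bigcup_(i in [set: I])
      ([set w | Y i w <= cut i] `&` (setT `&` [set w | (passage (x i) w < u%:E)%E]))).
    apply: fin_bigcup_measurable => // i _; apply: measurableI.
      have := mY i measurableT _ (measurable_itv `]-oo, cut i]).
      by rewrite preimage_itvNyc setTI.
    by apply: emeasurable_fun_infty_o => //; exact: passage_measurable.
  apply/seteqP; split=> w /=.
    by move=> /ereal_inf_lt[_ [i hi <-]] h; exists i.
  move=> [i _ [hi [_ h]]]; apply: le_lt_trans h.
  by apply: ereal_inf_lbound; exists i.
have tau_ge0 w : (0 <= tau w)%E.
  by apply: le_ereal_inf_tmp => _ [j hj <-]; exact/ltW/passage_gt0.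
pose X w := W (fine (tau w)) w.
have mX : measurable_fun setT X.
  apply: stopped_value_measurable.
  - exact: (cbm_measurable hW).
  - exact: (cbm_continuous hW).
  - exact: measurableT_comp.
  - by move=> w; exact: fine_ge0.
pose G i := first_alarm Y cut i `&` [set w | Y i w < 1].
have mY1 i : measurable [set w | Y i w < 1].
  by have := mY i measurableT _ (measurable_itv `]-oo, 1[); rewrite preimage_itvNyo setTI.
have mG i : measurable (G i) by apply: measurableI => //; exact: first_alarm_measurable.
have prG i : pr (G i) = p i.
  rewrite -hcut; apply: eq_pr_ae => //; first exact: first_alarm_measurable.
  by apply: filterS (Ylt i) => w h; split=> [[]|].
have GX i w : G i w -> (tau w < +oo)%E /\ X w = x i.
  move=> [hi Yi]; rewrite /X (tau_first _ _ hi).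
  have pgt := passage_gt0 w (x_neq0 i).
  have plt : (passage (x i) w < +oo)%E.
    by rewrite ltey -contract_eq1 lt_eqF.
  split=> //; apply: passage_value => //; rewrite fineK// ge0_fin_numE//.
  exact: ltW.
have Gdisj i j w : G i w -> G j w -> i = j.
  by move=> /GX[_ hi] /GX[_ hj]; apply: x_inj; rewrite -hi -hj.
have XA A : measurable A -> \sum_(i | x i \in A) p i <= pr (X @^-1` A).
  move=> mA; have mXA : measurable (X @^-1` A).
    by rewrite -[X in measurable X]setTI; exact: mX.
  rewrite -big_filter; under eq_bigr do rewrite -prG.
  rewrite -pr_bigcup_disj//; last first.
    by rewrite filter_uniq// index_enum_uniq.
  apply: le_pr => //; first exact: bigsetU_measurable.
  rewrite -bigcup_seq => w [i /=]; rewrite mem_filter => /andP[iA _] /GX[_ ->].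
  exact/set_mem.
exists b, c, tau, X; split.
- split.
  + move=> s t st; apply: ereal_inf_le_tmp => _ [i [xi hi] <-]; exists i => //; split => //.
    by apply: le_trans hi; rewrite le_contract lee_fin.
  + move=> s t st; apply: ereal_sup_le => _ [i [xi hi] <-]; exists i => //; split => //.
    by apply: le_trans hi; rewrite le_contract lee_fin.
  + by move=> t; apply: le_ereal_inf_tmp => _ [i [xi _] <-]; rewrite lee_fin ltW.
  + by move=> t; apply: ge_ereal_sup => _ [i [xi _] <-]; rewrite lee_fin ltW.
- by [].
- move=> w s ts.
  have : (tau w < (s + 1)%:E)%E by rewrite ts lte_fin; lra.
  move=> /ereal_inf_lt[_ [i0 /= hi0 _] _]; have [i hi] := first_ex _ _ hi0.
  have ps : passage (x i) w = s%:E by rewrite -ts (tau_first _ _ hi).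
  have Xi : X w = W s w by rewrite /X ts.
  have Wi : W s w = x i by exact: passage_value.
  have s0 : 0 < s by rewrite -lte_fin -ps passage_gt0.
  have cs : contract s%:E <= cut i by case: hi => hi _; rewrite -ps.
  split=> //; rewrite Xi Wi; have [xi|xi] := ltP 0 (x i); [left|right].
    by apply: ereal_inf_lbound; exists i.
  by apply: ereal_sup_ubound; exists i => //; split => //; rewrite lt_neqAle x_neq0.
- move=> w s s0 h.
  suff [i [ci xi]] : exists i, contract s%:E <= cut i /\ x i ^+ 2 < x i * W s w.
    have ps := passage_le s0 xi; apply: le_trans ps.
    apply: ereal_inf_lbound; exists i => //=; apply: le_trans ci.
    by rewrite /Y le_contract passage_le.
  case: h => [/ereal_inf_lt[_ [i [xi ci] <-]]|/ereal_sup_gt[_ [i [xi ci] <-]]];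
    rewrite lte_fin => h; exists i; split => //.
    by rewrite expr2 ltr_pM2l.
  by rewrite expr2 ltr_nM2l.
- split.
    have mt : measurable [set w | (tau w < +oo)%E].
      by rewrite -[X in measurable X]setTI; exact: emeasurable_fun_infty_o.
    apply/ae_prP => //; apply/eqP; rewrite eq_le pr_le1//= -p_sum.
    under eq_bigr do rewrite -prG.
    rewrite -pr_bigcup_disj ?index_enum_uniq//.
    apply: le_pr => //; first exact: bigsetU_measurable.
    by rewrite -bigcup_seq => w [i _ /GX[]].
  move=> A mA; apply/eqP; rewrite eq_le XA// andbT.
  have mXA : measurable (X @^-1` A).
    by rewrite -[X in measurable X]setTI; exact: mX.
  have := XA _ (measurableC mA); rewrite preimage_setC pr_setC//.
  have := p_sum; rewrite (bigID (fun i => x i \in A))/=.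
  under [in X in X <= _ -> _]eq_bigl do rewrite in_setC.
  lra.
Qed.

End discrete_embedding.

(** * Selection of a limit barrier *)

Section diagonal_extraction.
Context (R : realType).

(** Helly's selection: an ultrafilter gives a limit in the compact space of
   extended reals for every index at once, and any finite number of these
   convergences can be realised to any precision by arbitrarily late terms. *)
Lemma ereal_diagonal (J : countType) (u : nat -> J -> \bar R) :
  exists (phi : nat -> nat) (L : J -> \bar R),
    [/\ forall k, (k <= phi k)%N,
        forall j y, (L j < y)%E ->
          exists N, forall k, (N <= k)%N -> (u (phi k) j < y)%E &
        forall j y, (y < L j)%E ->
          exists N, forall k, (N <= k)%N -> (y < u (phi k) j)%E].
Proof.
have [U [UU subU]] := ultraFilterLemma (@eventually_filter : ProperFilter \oo).
have late k : U [set n | (k <= n)%N] by apply: subU; exists k.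
pose v j n := contract (u n j).
have lim j : exists l : R, [/\ `|l| <= 1 & v j n @[n --> U] --> l].
  have vI : U (v j @^-1` `[-1, 1]%classic).
    apply: filterS (late 0%N) => n _.
    by have := contract_le1 (u n j); rewrite /= in_itv/= ler_norml.
  have PF : ProperFilter (v j @ U) by exact: fmap_proper_filter.
  have [l [/=]] := @segment_compact R (-1) 1 _ PF vI.
  rewrite in_itv/= -ler_norml => l1 vl; exists l; split => // B nB.
  have [//|UC] := in_ultra_setVsetC (v j @^-1` B) UU.
  by have [y [nBy By]] := vl (~` B) B UC nB; case: (nBy By).
have [l hl] := choice lim.
have close k : U [set n | forall i, (i < k)%N -> forall j, unpickle i = Some j ->
    `|v j n - l j| < k.+1%:R^-1].
  have : forall m, U [set n | forall i, (i < m)%N -> forall j, unpickle i = Some j ->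
    `|v j n - l j| < k.+1%:R^-1].
    elim=> [|m IH]; first by apply: (filterS _ (late 0%N)).
    case e: (unpickle m) => [j0|]; last first.
      apply: filterS IH => n h i; rewrite ltnS leq_eqVlt => /predU1P[->|]; last exact: h.
      by move=> j; rewrite e.
    have [_ /cvgrPdist_lt/(_ k.+1%:R^-1)] := hl j0.
    rewrite invr_gt0 ltr0n => /(_ isT) hj0.
    apply: filterS2 IH hj0 => n h h0 i; rewrite ltnS leq_eqVlt.
    move=> /predU1P[->|]; last exact: h.
    by move=> j; rewrite e => -[<-]; rewrite distrC.
  exact.
have pick_late k : exists n, (k <= n)%N /\
    forall i, (i < k)%N -> forall j, unpickle i = Some j -> `|v j n - l j| < k.+1%:R^-1.
  exact: (filter_ex (filterI (late k) (close k))).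
have [phi hphi] := choice pick_late.
exists phi, (fun j => expand (l j)).
have ev j e : 0 < e -> exists N, forall k, (N <= k)%N -> `|v j (phi k) - l j| < e.
  move=> e0; exists (maxn (pickle j).+1 (Num.bound e^-1)) => k.
  rewrite geq_max => /andP[jk ek]; have [_ h] := hphi k.
  apply: lt_le_trans (h _ jk j (pickleK j)) _.
  rewrite invf_ple ?posrE ?ltr0n//; apply: ltW.
  apply: lt_le_trans (archi_boundP _) _; first by rewrite invr_ge0 ltW.
  by rewrite ler_nat leqW.
have lE j : contract (expand (l j)) = l j.
  by apply: expandK; rewrite inE; have [] := hl j.
split.
- by move=> k; have [] := hphi k.
- move=> j y lj; have : 0 < contract y - l j by rewrite subr_gt0 -lE lt_contract.
  move=> /(ev j)[N hN]; exists N => k /hN; rewrite ltr_distl => /andP[_ h].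
  rewrite -(lt_contract (u (phi k) j) y).
  by move: h; rewrite /v; lra.
- move=> j y lj; have : 0 < l j - contract y by rewrite subr_gt0 -lE lt_contract.
  move=> /(ev j)[N hN]; exists N => k /hN; rewrite ltr_distl => /andP[h _].
  rewrite -(lt_contract y (u (phi k) j)).
  by move: h; rewrite /v; lra.
Qed.

(** Only rational times strictly before [t] enter, which makes the barrier
   left-continuous for every [L]. *)
Definition lim_barrier (L : rat -> \bar R) (t : R) : \bar R :=
  ereal_sup [set L q | q in [set q : rat | 0 < (ratr q : R) < t]].

Lemma lim_barrier_homo L : {homo lim_barrier L : s t / s <= t >-> (s <= t)%E}.
Proof.
move=> s t st; apply: ereal_sup_le => _ [q /andP[q0 qs] <-]; exists q => //=.
by rewrite q0 (lt_le_trans qs).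
Qed.

Lemma lim_barrier_ge L q t : 0 < (ratr q : R) -> ratr q < t -> (L q <= lim_barrier L t)%E.
Proof. by move=> q0 qt; apply: ereal_sup_ubound; exists q => //=; rewrite q0. Qed.

Lemma lim_barrier_ge0 L t : (forall q, (0 <= L q)%E) -> 0 < t -> (0 <= lim_barrier L t)%E.
Proof.
move=> L0 t0; have [q] := rat_in_itvoo t0; rewrite in_itv/= => /andP[q0 qt].
exact: le_trans (L0 q) (lim_barrier_ge L q0 qt).
Qed.

Lemma lim_barrier_left_continuous L : left_continuous_on_pos (lim_barrier L).
Proof.
move=> t t0; apply/cvg_ballP => e e0.
pose S := [set L q | q in [set q : rat | 0 < (ratr q : R) < t]].
have [q0] := rat_in_itvoo t0; rewrite in_itv/= => q0t.
have SN : S !=set0 by exists (L q0), q0.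
have hS : has_sup (@contract R @` S).
  split; first by have [x Sx] := SN; exists (contract x), x.
  exists 1 => _ [x _ <-]; exact: le_trans (ler_norm _) (contract_le1 _).
have [_ [_ [q /= /andP[q1 qt] <-] <-]] := sup_adherent e0 hS.
rewrite -contract_sup// -/(lim_barrier L t) => hq.
near=> s.
have qs : ratr q < s by near: s; exact: nbhs_left_gt.
have st : s <= t by near: s; exact: nbhs_left_le.
rewrite /ball/= /ereal_ball ger0_norm.
  have := lim_barrier_ge L q1 qs; rewrite -le_contract; lra.
by rewrite subr_ge0 le_contract; exact: lim_barrier_homo.
Unshelve. all: by end_near.
Qed.

End diagonal_extraction.

(** * Passage to the limit *)

Section path_limits.
Context (R : realType).

Lemma accumulation_point (r M : R) (Q : nat -> R -> Prop) :
  (forall N, exists n s, [/\ (N <= n)%N, r <= s <= M & Q n s]) ->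
  exists2 t, r <= t <= M & forall e N, 0 < e ->
    exists n s, [/\ (N <= n)%N, `|s - t| < e & Q n s].
Proof.
move=> HQ.
pose F (A : set R) := exists N, forall n s, (N <= n)%N -> r <= s <= M -> Q n s -> A s.
have FF : ProperFilter F.
  apply: Build_ProperFilter_ex.
    by move=> A [N hN]; have [n [s [Nn sM Qs]]] := HQ N; exists s; exact: hN Qs.
  split.
  - by exists 0%N.
  - move=> A B [N hN] [N' hN']; exists (maxn N N') => n s.
    by rewrite geq_max => /andP[n1 n2] sM Qs; split; [exact: hN Qs|exact: hN' Qs].
  - by move=> A B AB [N hN]; exists N => n s Nn sM Qs; exact/AB/(hN _ _ Nn sM Qs).
have FI : F `[r, M]%classic by exists 0%N => n s _ sM _; rewrite /= in_itv.
have [t [/=]] := @segment_compact R r M F FF FI.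
rewrite in_itv/= => tM ct; exists t => // e N e0.
pose A := [set s | exists2 n, (N <= n)%N & Q n s].
have FA : F A by exists N => n s Nn _ Qs; exists n.
have [s [[n Nn Qs] st]] := ct A (ball t e) FA (nbhsx_ballx t _ e0).
by exists n, s; split => //; rewrite distrC.
Qed.

(** At an accumulation point [t] of hitting times [s] and for a rational [q < t],
   monotonicity gives [b n q <= b n s <= f s] infinitely often, and [f s] is close
   to [f t]. *)
Lemma limit_touch (f : R -> R) (b : nat -> R -> \bar R) (L : rat -> \bar R) (r M : R) :
  0 < r -> continuous f -> (forall n, {homo b n : s t / s <= t >-> (s <= t)%E}) ->
  (forall q y, (y < L q)%E ->
     exists N, forall n, (N <= n)%N -> (y < b n (ratr q))%E) ->
  (forall N, exists n s, [/\ (N <= n)%N, r <= s <= M & (b n s <= (f s)%:E)%E]) ->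
  exists2 t, r <= t <= M & (lim_barrier L t <= (f t)%:E)%E.
Proof.
move=> r0 cf bmono Ldown /accumulation_point[t tM ht]; exists t => //.
apply: ge_ereal_sup => _ [q /andP[q0 qt] <-]; rewrite leNgt; apply/negP => fL.
have [y fy yL] : exists2 y, f t < y & (y%:E < L q)%E.
  case: (L q) fL => [l| |//]; last by move=> _; exists (f t + 1); [lra|rewrite ltry].
  by rewrite lte_fin => h; exists ((f t + l) / 2); [|rewrite lte_fin]; lra.
have [N hN] := Ldown _ _ yL.
have fy0 : 0 < y - f t by rewrite subr_gt0.
have /cvgrPdist_lt/(_ _ fy0)[e /= e0 he] := cf t.
have [|n [s [Nn st bs]]] := ht (Num.min e (t - ratr q)) N.
  by rewrite lt_min e0 subr_gt0.
move: st; rewrite lt_min => /andP[se sq].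
have /he : `|t - s| < e by rewrite distrC.
have qs : ratr q <= s by move: sq; rewrite ltr_distl; lra.
have := le_trans (bmono n _ _ qs) bs; move/(lt_le_trans (hN n Nn)); rewrite lte_fin.
by move=> h1 /=; rewrite ltr_distl; lra.
Qed.

End path_limits.

Section barrier_limit.
Context d (T : measurableType d) (R : realType) (P : probability T R).
Context (W : R -> T -> R) (hW : continuous_bm P W).
Context (mu : probability (measurableTypeR R) R).
Hypothesis mu0 : mu [set 0] = 0%E.
Local Notation pr := (Pr P).
Local Notation prm := (Pr mu).

Context (b c : nat -> R -> \bar R) (tau : nat -> T -> \bar R) (X : nat -> T -> R)
  (pi_ : nat -> R -> R) (Lb Lc : rat -> \bar R).
Hypothesis b_mono : forall n, {homo b n : s t / s <= t >-> (s <= t)%E}.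
Hypothesis c_mono : forall n, {homo c n : s t / s <= t >-> (s <= t)%E}.
Hypothesis mtau : forall n, measurable_fun setT (tau n).
Hypothesis mX : forall n, measurable_fun setT (X n).
Hypothesis tau_ge0 : forall n w, (0 <= tau n w)%E.
Hypothesis tau_hit : forall n w s, tau n w = s%:E ->
  [/\ 0 < s, X n w = W s w & (b n s <= (X n w)%:E \/ c n s <= (- X n w)%:E)%E].
Hypothesis tau_cross : forall n w s, 0 < s ->
  (b n s < (W s w)%:E \/ c n s < (- W s w)%:E)%E -> (tau n w <= s%:E)%E.
Hypothesis tau_fin : forall n, {ae P, forall w, (tau n w < +oo)%E}.
Hypothesis X_law : forall n A, measurable A -> pr (X n @^-1` A) = prm (pi_ n @^-1` A).
Hypothesis mpi : forall n, measurable_fun setT (pi_ n).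
Hypothesis pi_cvg : forall y, pi_ n y @[n --> \oo] --> y.
Hypothesis Lb_up : forall q y, (Lb q < y)%E ->
  exists N, forall n, (N <= n)%N -> (b n (ratr q) < y)%E.
Hypothesis Lb_down : forall q y, (y < Lb q)%E ->
  exists N, forall n, (N <= n)%N -> (y < b n (ratr q))%E.
Hypothesis Lc_up : forall q y, (Lc q < y)%E ->
  exists N, forall n, (N <= n)%N -> (c n (ratr q) < y)%E.
Hypothesis Lc_down : forall q y, (y < Lc q)%E ->
  exists N, forall n, (N <= n)%N -> (y < c n (ratr q))%E.

(** The lower barrier is described by its opposite, which is increasing, so that
   both barriers obey the same lemmas, for [W] and for [- W]. *)
Definition crosses (t : R) (w : T) : Prop :=
  (lim_barrier Lb t < (W t w)%:E \/ lim_barrier Lc t < (- W t w)%:E)%E.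
Definition touches (t : R) (w : T) : Prop :=
  (lim_barrier Lb t <= (W t w)%:E \/ lim_barrier Lc t <= (- W t w)%:E)%E.

Local Notation sigma := (first_time crosses).

Lemma first_time_touch_cross : {ae P, forall w, first_time touches w = sigma w}.
Proof.
have h1 := touch_then_cross hW (f := lim_barrier Lb)
  (fun s t _ st => lim_barrier_homo Lb st).
have h2 := touch_then_cross (continuous_bm_opp hW) (f := lim_barrier Lc)
  (fun s t _ st => lim_barrier_homo Lc st).
apply: filterS2 h1 h2 => w h1 h2; apply/eqP; rewrite eq_le; apply/andP; split.
  apply: ereal_inf_le_tmp => _ [t [t0 ht] <-]; exists t => //; split => //.
  by case: ht => /ltW; [left|right].
apply: le_ereal_inf_tmp => _ [t [t0 ht] <-]; apply/lee_addgt0Pr => e e0.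
have te : t < t + e by lra.
case: ht => ht.
  have [s /andP[s0 st] hs] := h1 t t0 ht _ te; rewrite -EFinD.
  apply: (@le_trans _ _ s%:E); last by rewrite lee_fin ltW.
  by apply: ereal_inf_lbound; exists s => //; split => //; left.
have [s /andP[s0 st] hs] := h2 t t0 ht _ te; rewrite -EFinD.
apply: (@le_trans _ _ s%:E); last by rewrite lee_fin ltW.
by apply: ereal_inf_lbound; exists s => //; split => //; right.
Qed.

Let cross_left w t : 0 < t -> crosses t w ->
  exists2 r, 0 < r & forall s, 0 < s -> t - r < s <= t ->
    (lim_barrier Lb t < (W s w)%:E \/ lim_barrier Lc t < (- W s w)%:E)%E.
Proof.
have gen (f : R -> R) (z : \bar R) : continuous f -> (z < (f t)%:E)%E ->
    exists2 r, 0 < r & forall s, t - r < s <= t -> (z < (f s)%:E)%E.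
  move=> cf; case: z => [z| //|] hz; last by exists 1 => // *; rewrite ltNyr.
  rewrite lte_fin -subr_gt0 in hz; have /cvgrPdist_lt/(_ _ hz)[e /= e0 he] := cf t.
  exists e => // s /andP[ts st]; have /he : `|t - s| < e by rewrite ltr_distl; lra.
  by rewrite ltr_distl lte_fin; lra.
move=> t0 [h|h].
  have [r r0 hr] := gen _ _ (@cbm_continuous _ _ _ _ _ hW w) h.
  by exists r => // s _ hs; left; exact: hr.
have [r r0 hr] := gen _ _ (@cbm_continuous _ _ _ _ _ (continuous_bm_opp hW) w) h.
by exists r => // s _ hs; right; exact: hr.
Qed.

Lemma sigma_measurable : measurable_fun setT sigma.
Proof.
apply: first_time_measurable => [t t0|w t t0 h].
  rewrite (_ : [set w | crosses t w] =
    [set w | [set y | (lim_barrier Lb t < y%:E)%E] (W t w)] `|`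
    [set w | [set y | (lim_barrier Lc t < (- y)%:E)%E] (W t w)]); last first.
    by apply/seteqP; split=> w.
  apply: measurableU; apply: (cbm_value_measurable hW).
    rewrite -[X in measurable X]setTI; apply: emeasurable_fun_o_infty => //.
  rewrite -[X in measurable X]setTI; apply: emeasurable_fun_o_infty => //.
  by apply/measurable_EFinP; exact: measurable_funN.
have [r r0 hr] := cross_left t0 h; exists r => // s s0 /[dup] hs /andP[_ st].
case: (hr s s0 hs) => hh; [left|right].
  by apply: le_lt_trans hh; exact: lim_barrier_homo.
by apply: le_lt_trans hh; exact: lim_barrier_homo.
Qed.

Lemma cross_eventually w t : 0 < t -> crosses t w ->
  exists N, forall n, (N <= n)%N -> (tau n w <= t%:E)%E.
Proof.
move=> t0 h; have [r r0 hr] := cross_left t0 h.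
have : Num.max 0 (t - r) < t by rewrite gt_max t0; lra.
move=> /rat_in_itvoo[q]; rewrite in_itv/= gt_max => /andP[/andP[q0 rq] qt].
have qh : t - r < ratr q <= t by rewrite rq ltW.
have [h'|h'] := hr _ q0 qh.
  have [N hN] := Lb_up (le_lt_trans (lim_barrier_ge Lb q0 qt) h').
  exists N => n /hN hn; apply: le_trans (_ : _ <= (ratr q)%:E)%E _.
    by apply: tau_cross => //; left.
  by rewrite lee_fin ltW.
have [N hN] := Lc_up (le_lt_trans (lim_barrier_ge Lc q0 qt) h').
exists N => n /hN hn; apply: le_trans (_ : _ <= (ratr q)%:E)%E _.
  by apply: tau_cross => //; right.
by rewrite lee_fin ltW.
Qed.

Lemma sigma_lt_eventually w u : (sigma w < u%:E)%E ->
  exists N, forall n, (N <= n)%N -> (tau n w <= u%:E)%E.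
Proof.
move=> /ereal_inf_lt[_ [t [t0 ht] <-]]; rewrite lte_fin => tu.
have [N hN] := cross_eventually t0 ht; exists N => n /hN h.
by apply: le_trans h _; rewrite lee_fin ltW.
Qed.

(** Approximating hitting times that stay in the compact interval [[r, M]] would
   accumulate at a time where the limit barrier is touched. *)
Lemma no_early_accumulation w r M : 0 < r -> (M%:E < first_time touches w)%E ->
  exists N, forall n s, (N <= n)%N -> tau n w = s%:E -> s < r \/ M < s.
Proof.
move=> r0 Mt; apply: contrapT => nN.
have {}nN N : exists n s, [/\ (N <= n)%N, r <= s <= M & tau n w = s%:E].
  apply: contrapT => nE; apply: nN; exists N => n s Nn ts.
  have [sr|rs] := ltP s r; first by left.
  have [Ms|sM] := ltP M s; first by right.
  by exfalso; apply: nE; exists n, s; rewrite rs.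
have notouch t : r <= t <= M -> ~ touches t w.
  move=> /andP[rt tM] h; have : (first_time touches w <= t%:E)%E.
    by apply: ereal_inf_lbound; exists t => //; split => //; exact: lt_le_trans rt.
  by move=> /(lt_le_trans Mt); rewrite lte_fin ltNge tM.
have [Hu|nHu] := pselect (forall N, exists n s,
    [/\ (N <= n)%N, r <= s <= M & (b n s <= (W s w)%:E)%E]).
  have [t tM ht] := limit_touch r0 (@cbm_continuous _ _ _ _ _ hW w) b_mono Lb_down Hu.
  by apply: (notouch t tM); left.
have [N0 hN0] : exists N, forall n s, (N <= n)%N -> r <= s <= M ->
    ~ (b n s <= (W s w)%:E)%E.
  apply: contrapT => nE; apply: nHu => N; apply: contrapT => nE'; apply: nE.
  by exists N => n s Nn sM h; apply: nE'; exists n, s.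
have [|t tM ht] := limit_touch r0
    (@cbm_continuous _ _ _ _ _ (continuous_bm_opp hW) w) c_mono Lc_down (M := M).
  move=> N; have [n [s [Nn sM ts]]] := nN (maxn N N0).
  move: Nn; rewrite geq_max => /andP[Nn N0n]; exists n, s; split => //.
  have [_ Xs [h|h]] := tau_hit ts; last by rewrite -Xs.
  by exfalso; apply: (hN0 n s) => //; rewrite -Xs.
by apply: (notouch t tM); right.
Qed.

Let mpre n A : measurable A -> measurable (X n @^-1` A).
Proof. by move=> mA; rewrite -[X in measurable X]setTI; exact: mX. Qed.

(** The complement of [A] is open, so that points outside of [A] are eventually
   mapped outside of [A] by [pi_ n]; then Fatou's lemma applies. *)
Lemma portmanteau_closed (A : set R) e : closed A -> 0 < e ->
  exists N, forall n, (N <= n)%N -> pr (X n @^-1` A) < prm A + e.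
Proof.
move=> cA e0; have mA : measurable A by exact: closed_measurable.
have mpA n : measurable (pi_ n @^-1` A).
  by rewrite -[X in measurable X]setTI; exact: mpi.
have [|N hN] := @pr_liminf _ _ _ mu (~` A) (fun n => ~` (pi_ n @^-1` A))
    (measurableC mA) (fun n => measurableC (mpA n)) _ e e0.
  apply: aeW => y /= nAy; have nb : nbhs y (~` A).
    by apply: open_nbhs_nbhs; split => //; exact: closed_openC.
  by have [N _ hN] := pi_cvg nb; exists N => n /hN.
exists N => n /hN h; rewrite (pr_setC mu mA) (pr_setC mu (mpA n)) in h.
by rewrite X_law//; lra.
Qed.

Let mtau_lt n u : measurable [set w | (tau n w < u)%E].
Proof.
by rewrite -[X in measurable X]setTI; exact: emeasurable_fun_infty_o.
Qed.

Let msigma_lt u : measurable [set w | (sigma w < u)%E].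
Proof.
rewrite -[X in measurable X]setTI; apply: emeasurable_fun_infty_o => //.
exact: sigma_measurable.
Qed.

(** The approximating hitting times are bounded away from [0] uniformly: a path
   stopped early stops near [0], and [mu] has no atom there. *)
Lemma tau_not_small e : 0 < e ->
  exists2 r, 0 < r & exists N, forall n, (N <= n)%N ->
    pr [set w | (tau n w < r%:E)%E] <= e.
Proof.
move=> e0; have e30 : 0 < e / 3 by rewrite divr_gt0.
pose I (k : nat) : set R := `[- k.+1%:R^-1, k.+1%:R^-1]%classic.
have [k w|k /(_ k (leqnn _)) hk] := pr_nonincreasing mu (F := I) (fun k => measurable_itv _) _ e30.
  have le : k.+2%:R^-1 <= k.+1%:R^-1 :> R by rewrite lef_pV2 ?posrE ?ltr0n// ler_nat.
  rewrite /I /= !in_itv/= => /andP[h1 h2]; apply/andP; split.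
    by apply: le_trans h1; rewrite lerN2.
  exact: le_trans h2 le.
rewrite (_ : \bigcap_n _ = [set 0]) in hk; last first.
  apply/seteqP; split=> y /= h; last first.
    by rewrite h => n _; rewrite /I /= in_itv/= oppr_le0 invr_ge0 ler0n.
  apply/eqP; rewrite -normr_le0; apply/ler_addgt0Pr => u u0; rewrite add0r.
  have hy : I (Num.bound u^-1) y := h _ Logic.I.
  move: hy; rewrite /I /= in_itv/= -ler_norml => hy.
  apply: le_trans hy _; rewrite invf_ple ?posrE ?ltr0n//; apply: ltW.
  apply: lt_le_trans (archi_boundP _) _; first by rewrite invr_ge0 ltW.
  by rewrite ler_nat.
have pm0 : prm [set 0] = 0 by rewrite /Pr mu0.
rewrite pm0 add0r in hk.
set eta : R := k.+1%:R^-1.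
have eta0 : 0 < eta by rewrite invr_gt0 ltr0n.
have [N hN] := portmanteau_closed (@itv_closed _ _ (- eta) eta) e30.
pose O (j : nat) := [set w | forall q : rat, 0 < (ratr q : R) < j.+1%:R^-1 -> `|W (ratr q) w| <= eta].
have mO j : measurable (O j).
  pose G (q : rat) := [set w | 0 < (ratr q : R) < j.+1%:R^-1 /\ ~ `|W (ratr q) w| <= eta].
  have -> : O j = ~` (\bigcup_q G q).
    apply/seteqP; split=> w /=.
      by move=> h [q _ [qj]]; apply; exact: h.
    by move=> h q qj; apply: contrapT => hq; apply: h; exists q.
  apply: measurableC; apply: bigcupT_measurable_rat => q; rewrite /G.
  have [qj|nqj] := pselect (0 < (ratr q : R) < j.+1%:R^-1); last first.
    by rewrite (_ : [set w | _] = set0)//; apply/seteqP; split=> // w [].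
  rewrite (_ : [set w | _] = ~` [set w | `[- eta, eta]%classic (W (ratr q) w)]).
    by apply: measurableC; exact: (cbm_value_measurable hW).
  by apply/seteqP; split=> w /=; rewrite in_itv/= -ler_norml; [case|split].
have OS j : O j `<=` O j.+1.
  move=> w h q /andP[q0 qj]; apply: h; rewrite q0; apply: lt_le_trans qj _.
  by rewrite lef_pV2 ?posrE ?ltr0n// ler_nat.
have [j /(_ j (leqnn _)) hj] := pr_nondecreasing P mO OS e30.
have OT : \bigcup_j O j = setT.
  apply/seteqP; split=> // w _; have [r r0 hr] := cbm_near hW w 0 eta0.
  exists (Num.bound r^-1) => // q /andP[q0 qr].
  have := hr (ratr q); rewrite (cbm_start hW) !subr0 gtr0_norm// => h.
  apply/ltW/h; apply: lt_le_trans qr _.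
  rewrite invf_ple ?posrE ?ltr0n//; apply: ltW.
  apply: lt_le_trans (archi_boundP _) _; first by rewrite invr_ge0 ltW.
  by rewrite ler_nat.
rewrite OT prT in hj.
exists j.+1%:R^-1; first by rewrite invr_gt0 ltr0n.
exists N => n Nn; have hn := hN n Nn.
have mXI : measurable (X n @^-1` `[- eta, eta]%classic) by exact: mpre.
have h1 : pr [set w | (tau n w < j.+1%:R^-1%:E)%E] <=
    pr (X n @^-1` `[- eta, eta]%classic `|` ~` O j).
  apply: le_pr => //; first by apply: measurableU => //; exact: measurableC.
  move=> w /=; case e1: (tau n w) (tau_ge0 n w) => [s| |]// _.
  rewrite lte_fin => sj; have [s0 Xs _] := tau_hit e1.
  have [XI|XI] := boolP (X n w \in `[- eta, eta]); first by left.
  right => Ow; move: XI; rewrite in_itv/= -ler_norml -ltNge Xs -subr_gt0 => h.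
  have [r r0 hr] := cbm_near hW w s h.
  have : s < Num.min j.+1%:R^-1 (s + r) by rewrite lt_min sj; lra.
  move=> /rat_in_itvoo[q]; rewrite in_itv/= lt_min => /andP[sq /andP[qj qs]].
  have /hr : `|ratr q - s| < r by rewrite ltr_distl; lra.
  have := Ow q; rewrite (lt_trans s0 sq) qj => /(_ isT).
  have := ler_normD (W (ratr q) w) (W s w - W (ratr q) w).
  rewrite addrC subrK -distrC; lra.
have h2 := pr_setU_le P mXI (measurableC (mO j)).
rewrite pr_setC// in h2.
move: hk; rewrite -/eta -/(I k) => hk.
have : prm `[- eta, eta]%classic < e / 3 by exact: hk.
lra.
Qed.

Let msigma : measurable_fun setT sigma.
Proof. exact: sigma_measurable. Qed.

Lemma sigma_gt0 : {ae P, forall w, (0 < sigma w)%E}.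
Proof.
suff h0 : pr [set w | (sigma w <= 0%:E)%E] = 0.
  have mle : measurable [set w | (sigma w <= 0%:E)%E].
    by rewrite -[X in measurable X]setTI; exact: emeasurable_fun_infty_c.
  by move/(ae_pr0P _ mle): h0; apply: filterS => w /negP; rewrite -ltNge.
apply/eqP; rewrite eq_le pr_ge0 andbT; apply/ler_addgt0Pr => e e0; rewrite add0r.
have e20 : 0 < e / 2 by rewrite divr_gt0.
have [r r0 [N hN]] := tau_not_small e20.
have [|N' hN'] := @pr_liminf _ _ _ P [set w | (sigma w < (r / 2)%:E)%E]
   (fun n => [set w | (tau n w < r%:E)%E]) (msigma_lt _) (fun n => mtau_lt n _) _ _ e20.
  apply: aeW => w /= /sigma_lt_eventually[M hM]; exists M => n /hM h.
  by apply: le_lt_trans h _; rewrite lte_fin; lra.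
have h1 : pr [set w | (sigma w <= 0%:E)%E] <= pr [set w | (sigma w < (r / 2)%:E)%E].
  apply: le_pr => //.
    by rewrite -[X in measurable X]setTI; exact: emeasurable_fun_infty_c.
  by move=> w /= h; apply: le_lt_trans h _; rewrite lte_fin; lra.
have := hN (maxn N N') (leq_maxl _ _); have := hN' (maxn N N') (leq_maxr _ _).
lra.
Qed.

(** A bounded barrier is hit because paths are unbounded. If neither barrier is
   bounded, then stopping after a late time means stopping far from [0], and the
   tails of [mu] control the probability of this uniformly. *)
Lemma sigma_lty : {ae P, forall w, (sigma w < +oo)%E}.
Proof.
have bounded_case (V : R -> T -> R) (hV : continuous_bm P V) (L : rat -> \bar R) (K : R) :
    (forall t, 0 < t -> (lim_barrier L t <= K%:E)%E) ->
    (forall w t, (lim_barrier L t < (V t w)%:E)%E -> crosses t w) ->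
    {ae P, forall w, (sigma w < +oo)%E}.
  move=> LK Vc; apply: filterS (cbm_unbounded hV) => w /(_ K)[t t0 Kt].
  apply: le_lt_trans (ltry t); apply: ereal_inf_lbound; exists t => //; split => //.
  by apply: Vc; apply: le_lt_trans (LK _ t0) _; rewrite lte_fin.
have [[K hK]|nK] := pselect (exists K : R, forall t, 0 < t -> (lim_barrier Lb t <= K%:E)%E).
  by apply: (bounded_case _ hW Lb K hK) => w t h; left.
have [[K' hK']|nK'] := pselect (exists K : R, forall t, 0 < t -> (lim_barrier Lc t <= K%:E)%E).
  by apply: (bounded_case _ (continuous_bm_opp hW) Lc K' hK') => w t h; right.
have high (L : rat -> \bar R) (K : R) :
    ~ (exists K : R, forall t, 0 < t -> (lim_barrier L t <= K%:E)%E) ->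
    exists2 q : rat, 0 < (ratr q : R) & (K%:E < L q)%E.
  move=> nb; apply: contrapT => nq; apply: nb; exists K => t t0.
  apply: ge_ereal_sup => _ [q /andP[q0 qt] <-]; rewrite leNgt; apply/negP => h.
  by apply: nq; exists q.
have minf : measurable [set w | (+oo <= sigma w)%E].
  by rewrite -[X in measurable X]setTI; exact: emeasurable_fun_c_infty.
suff h0 : pr [set w | (+oo <= sigma w)%E] = 0.
  by move/(ae_pr0P _ minf): h0; apply: filterS => w /negP; rewrite -ltNge.
apply/eqP; rewrite eq_le pr_ge0 andbT; apply/ler_addgt0Pr => e e0; rewrite add0r.
have e40 : 0 < e / 4 by rewrite divr_gt0.
have [K0 hK0] := pr_tight mu (@measurable_id _ (measurableTypeR R) setT) e40.
pose K : R := K0%:R + 1.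
pose far : set R := ~` `]- K, K[%classic.
have cfar : closed far by apply: open_closedC; exact: interval_open.
have mfar : measurable far by exact: closed_measurable.
have pfar : prm far < e / 4.
  apply: le_lt_trans hK0; apply: le_pr => //.
    have /(_ measurableT _ (measurable_itv `]K0%:R, +oo[)) :
      measurable_fun setT (fun y : R => `|y|) by exact: normr_measurable.
    by rewrite preimage_itvoy setTI.
  move=> y; rewrite /far /= in_itv/= -ltr_norml => /negP; rewrite -leNgt /K => h.
  by apply: lt_le_trans h; lra.
have [N1 hN1] := portmanteau_closed cfar e40.
have [q q0 hq] := high Lb K nK; have [q' q'0 hq'] := high Lc K nK'.
have [N2 hN2] := Lb_down hq; have [N3 hN3] := Lc_down hq'.
pose M := Num.max (ratr q : R) (ratr q').
have [qM q'M] : ratr q <= M /\ ratr q' <= M by rewrite !le_max !lexx orbT.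
have [r r0 [N4 hN4]] := tau_not_small e40.
pose F n := [set w | (tau n w < r%:E)%E] `|` X n @^-1` far.
have mF n : measurable (F n) by apply: measurableU => //; exact: mpre.
have [|N5 hN5] := @pr_liminf _ _ _ P _ F minf mF _ _ e40.
  apply: filterS2 first_time_touch_cross (ae_foralln tau_fin) => w st tf /= sy.
  have [|N6 hN6] := @no_early_accumulation w r M r0.
    by rewrite st; apply: lt_le_trans sy; exact: ltry.
  exists (maxn N6 (maxn N2 N3)) => n; rewrite !geq_max => /and3P[n6 n2 n3].
  case e1: (tau n w) (tf n) (tau_ge0 n w) => [s| |]// _ _.
  have [sr|Ms] := hN6 n s n6 e1; [left; rewrite /= e1 lte_fin//|right].
  have [s0 Xs hit] := tau_hit e1; rewrite /far /= in_itv/= -ltr_norml.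
  apply/negP; rewrite -leNgt; case: hit => hit.
    have : (K%:E < (X n w)%:E)%E.
      apply: lt_le_trans (hN2 n n2) _; apply: le_trans hit; apply: b_mono.
      exact: le_trans qM (ltW Ms).
    by rewrite lte_fin => h; rewrite ltW// (lt_le_trans h)// ler_norm.
  have : (K%:E < (- X n w)%:E)%E.
    apply: lt_le_trans (hN3 n n3) _; apply: le_trans hit; apply: c_mono.
    exact: le_trans q'M (ltW Ms).
  by rewrite lte_fin -normrN => h; rewrite ltW// (lt_le_trans h)// ler_norm.
pose n := maxn N1 (maxn N4 N5).
have [n1 n4 n5] : [/\ (N1 <= n)%N, (N4 <= n)%N & (N5 <= n)%N].
  by rewrite /n !leq_max !leqnn !orbT.
have := hN5 n n5; have := hN1 n n1; have := hN4 n n4.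
have := pr_setU_le P (mtau_lt n r%:E) (mpre n mfar); rewrite -/(F n).
lra.
Qed.

Definition limit_value (w : T) : R := W (fine (sigma w)) w.

Lemma limit_value_measurable : measurable_fun setT limit_value.
Proof.
apply: stopped_value_measurable.
- exact: (cbm_measurable hW).
- exact: (cbm_continuous hW).
- exact: measurableT_comp.
- move=> w; apply: fine_ge0; apply: le_ereal_inf_tmp => _ [t [t0 _] <-].
  by rewrite lee_fin ltW.
Qed.

Let mlim A : measurable A -> measurable (limit_value @^-1` A).
Proof. by move=> mA; rewrite -[X in measurable X]setTI; exact: limit_value_measurable. Qed.

(** A path with limit value in [O] is stopped by the approximating barriers either
   before any fixed time [r], which is unlikely, or eventually in [O]; the closed
   set [A] serves to compare the approximating laws with [mu]. *)
Lemma limit_law_le (O A : set R) : open O -> closed A -> O `<=` A ->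
  pr (limit_value @^-1` O) <= prm A.
Proof.
move=> oO cA OA; apply/ler_addgt0Pr => e e0.
have mO : measurable O by exact: open_measurable.
have mA : measurable A by exact: closed_measurable.
have e30 : 0 < e / 3 by rewrite divr_gt0.
have [r r0 [N1 hN1]] := tau_not_small e30.
have [N2 hN2] := portmanteau_closed cA e30.
pose F n := [set w | (tau n w < r%:E)%E] `|` X n @^-1` A.
have mF n : measurable (F n) by apply: measurableU => //; exact: mpre.
have [|N3 hN3] := @pr_liminf _ _ _ P _ F (mlim mO) mF _ _ e30.
  apply: filterS3 first_time_touch_cross sigma_gt0 sigma_lty => w st s0 sy.
  rewrite /limit_value /=; case es: (sigma w) s0 sy => [u| |]//= u0 _ Ou.
  have nO : nbhs (W u w) O by exact: open_nbhs_nbhs.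
  have := @cbm_continuous _ _ _ _ _ hW w u O nO => -[dl /= dl0 hdl].
  have [|N6 hN6] := @no_early_accumulation w r (u - dl / 2) r0.
    by rewrite st es lte_fin; lra.
  have [|N7 hN7] := @sigma_lt_eventually w (u + dl / 2); first by rewrite es lte_fin; lra.
  exists (maxn N6 N7) => n; rewrite geq_max => /andP[n6 n7].
  have := hN7 n n7; case e1: (tau n w) (tau_ge0 n w) => [s| |]// _; rewrite lee_fin => su.
  have [sr|us] := hN6 n s n6 e1; [left; rewrite /= e1 lte_fin//|right].
  have [_ Xs _] := tau_hit e1; rewrite /= Xs; apply/OA/hdl => /=.
  by rewrite ltr_distl; lra.
pose n := maxn N1 (maxn N2 N3).
have [n1 n2 n3] : [/\ (N1 <= n)%N, (N2 <= n)%N & (N3 <= n)%N].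
  by rewrite /n !leq_max !leqnn !orbT.
have := hN1 n n1; have := hN2 n n2; have := hN3 n n3.
have := pr_setU_le P (mtau_lt n r%:E) (mpre n mA); rewrite -/(F n).
lra.
Qed.

End barrier_limit.

(** * Laws on the line *)

Section laws_on_the_line.
Context (R : realType).
Implicit Types nu mu : probability R R.

Lemma ray_right_continuous nu y e : 0 < e ->
  exists2 z, y < z & Pr nu `]-oo, z]%classic < Pr nu `]-oo, y]%classic + e.
Proof.
move=> e0; pose F (n : nat) : set R := `]-oo, y + n.+1%:R^-1]%classic.
have [n w|n /(_ n (leqnn _)) h] := pr_nonincreasing nu (F := F) (fun n => measurable_itv _) _ e0.
  rewrite /F /= !in_itv/= => /le_trans; apply; rewrite lerD2l.
  by rewrite lef_pV2 ?posrE ?ltr0n// ler_nat.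
exists (y + n.+1%:R^-1); first by rewrite ltrDl invr_gt0 ltr0n.
rewrite (_ : `]-oo, y]%classic = \bigcap_n F n)//.
apply/seteqP; split=> w.
  rewrite /= in_itv/= => wy m _; rewrite /F /= in_itv/=; apply: le_trans wy _.
  by rewrite lerDl invr_ge0 ler0n.
move=> hw; rewrite /= in_itv/=; apply/ler_addgt0Pr => r r0.
have : F (Num.bound r^-1) w by exact: hw.
rewrite /F /= in_itv/= => /le_trans; apply; rewrite lerD2l.
rewrite invf_ple ?posrE ?ltr0n//; apply: ltW.
apply: lt_le_trans (archi_boundP _) _; first by rewrite invr_ge0 ltW.
by rewrite ler_nat.
Qed.

(** The two inequalities determine the distribution function at all points, since
   it is right-continuous. *)
Lemma eq_law_of_rays nu mu :
  (forall z, Pr nu `]-oo, z[%classic <= Pr mu `]-oo, z]%classic) ->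
  (forall z, Pr nu `]z, +oo[%classic <= Pr mu `[z, +oo[%classic) ->
  forall A : set R, measurable A -> nu A = mu A.
Proof.
move=> lo hi.
have rays y : Pr nu `]-oo, y]%classic = Pr mu `]-oo, y]%classic.
  apply/eqP; rewrite eq_le; apply/andP; split; apply/ler_addgt0Pr => e e0.
    have [z yz hz] := ray_right_continuous mu y e0.
    apply: le_trans (ltW hz); apply: le_trans (lo z); apply: le_pr => // w.
    by rewrite /= !in_itv/= => /le_lt_trans; exact.
  have [z yz hz] := ray_right_continuous nu y e0.
  apply: le_trans (ltW hz).
  have e1 : Pr nu `]-oo, z]%classic = 1 - Pr nu `]z, +oo[%classic.
    by rewrite -pr_setC// setCitvr.
  have e2 : Pr mu `]-oo, z[%classic = 1 - Pr mu `[z, +oo[%classic.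
    by rewrite -pr_setC// setCitvr.
  have h1 : Pr mu `]-oo, y]%classic <= Pr mu `]-oo, z[%classic.
    by apply: le_pr => // w; rewrite /= !in_itv/= => /le_lt_trans; exact.
  have := hi z; lra.
pose g (n : nat) : set R := `]- n%:R, n%:R]%classic.
move=> A mA; apply: (measure_unique (@ocitv R) g _ _ _ _ nu mu) => //.
- exact: ocitvI.
- by move=> i; exact: is_ocitv.
- apply/seteqP; split=> // w _; exists (Num.bound `|w|).+1 => //.
  rewrite /g /= in_itv/=; have := archi_boundP (normr_ge0 w).
  have := ler_norm w; have := ler_norm (- w); rewrite normrN -natr1; lra.
- move=> _ [[a b] _ <-] /=.
  have [ab|ba] := ltP a b; last by rewrite set_itv_ge ?measure0// bnd_simp -leNgt.
  have split_ (n : probability R R) :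
      Pr n `]-oo, b]%classic = Pr n `]-oo, a]%classic + Pr n `]a, b]%classic.
    have -> : `]a, b]%classic = `]-oo, b]%classic `\` `]-oo, a]%classic :> set R.
      by apply/seteqP; split=> w /=; rewrite !in_itv/=; [move=> /andP[h1 h2]; split => //; apply/negP; rewrite -ltNge|move=> [-> /negP]; rewrite -ltNge => ->].
    rewrite (pr_setID n (measurable_itv `]-oo, b]) (measurable_itv `]-oo, a])).
    rewrite setIidr// => w; rewrite /= !in_itv/= => h; apply: le_trans h _; exact: ltW.
  by rewrite !prE//; congr EFin; have := split_ nu; have := split_ mu; rewrite !rays; lra.
- move=> n; apply: (@le_lt_trans _ _ 1%E); last exact: ltry.
  by apply: probability_le1; exact: measurable_itv.
Qed.

Import HBSimple.

(** The value [0] is replaced by [n.+1%:R^-1], as [0] is not a level at which a path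
   can be stopped after time [0]. *)
Lemma nonzero_simple_approximation : exists pi_ : nat -> R -> R,
  [/\ forall n, measurable_fun setT (pi_ n), forall n, finite_set (range (pi_ n)),
      forall n y, pi_ n y != 0 & forall y, pi_ n y @[n --> \oo] --> y].
Proof.
have mid : measurable_fun [set: measurableTypeR R] (EFin \o (@id R)).
  by apply/measurable_EFinP; exact: measurable_id.
have [g hg] := approximation_sfun measurableT mid.
exists (fun n (y : R) => if g n y == 0 then n.+1%:R^-1 else g n y); split.
- move=> n; rewrite (_ : (fun _ => _) =
      (fun y => g n y + n.+1%:R^-1 * \1_(g n @^-1` [set 0]) y)).
    apply: (@measurable_funD _ (measurableTypeR R) R setT (g n)); first exact: measurable_funP.
    apply: (@measurable_funM _ (measurableTypeR R) R setT (cst n.+1%:R^-1) (\1_(g n @^-1` [set 0]))).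
      exact: measurable_cst.
    by apply: measurable_indic; rewrite -[X in measurable X]setTI; exact: measurable_funP.
  apply/funext => y; rewrite indicE; case: eqP => gy.
    by rewrite mem_set// mulr1 gy add0r.
  by rewrite memNset// mulr0 addr0.
- move=> n.
  apply: (@sub_finite_set _ _ (range (g n) `|` [set n.+1%:R^-1])).
    by move=> _ [y _ <-]; case: ifP; [right|left; exists y].
  by rewrite finite_setU; split.
- by move=> n y; case: ifPn => // _; rewrite invr_eq0 pnatr_eq0.
- move=> y; have /fine_cvgP[_ /= gy] := hg y Logic.I.
  have inv0 : (n.+1%:R^-1 : R) @[n --> \oo] --> 0 by exact: cvg_harmonic.
  apply/cvgrPdist_lt => e e0; have e20 : 0 < e / 2 by rewrite divr_gt0.
  move/cvgrPdist_lt: gy => /(_ _ e20) gy; move/cvgrPdist_lt: inv0 => /(_ _ e20) inv0.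
  near=> n; have h1 : `|y - g n y| < e / 2 by near: n.
  have : `|0 - n.+1%:R^-1 : R| < e / 2 by near: n.
  rewrite sub0r normrN => h2; case: eqP => g0; last lra.
  rewrite g0 subr0 in h1; apply: le_lt_trans (ler_normB _ _) _; lra.
Unshelve. all: by end_near.
Qed.

End laws_on_the_line.

(** * Embedding an arbitrary law *)

Section embedding.
Context d (T : measurableType d) (R : realType) (P : probability T R).
Context (W : R -> T -> R) (hW : continuous_bm P W).
Context (mu : probability (measurableTypeR R) R).
Local Notation prP := (Pr P).
Local Notation prm := (Pr mu).

Lemma simple_embedding (g : R -> R) :
  measurable_fun setT g -> finite_set (range g) -> (forall y, g y != 0) ->
  exists z : (R -> \bar R) * (R -> \bar R) * (T -> \bar R) * (T -> R),
    let: (b, c, tau, X) := z in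
    [/\ [/\ {homo b : s t / s <= t >-> (s <= t)%E},
            {homo c : s t / s <= t >-> (s <= t)%E},
            forall t, (0 <= b t)%E & forall t, (0 <= c t)%E],
        [/\ measurable_fun setT tau, forall w, (0 <= tau w)%E & measurable_fun setT X],
        forall w s, tau w = s%:E ->
          [/\ 0 < s, X w = W s w & (b s <= (X w)%:E \/ c s <= (- X w)%:E)%E],
        forall w s, 0 < s -> (b s < (W s w)%:E \/ c s < (- W s w)%:E)%E ->
          (tau w <= s%:E)%E &
        {ae P, forall w, (tau w < +oo)%E} /\
        forall A : set R, measurable A -> prP (X @^-1` A) = prm (g @^-1` A)].
Proof.
move=> mg fg g0.
have /finite_seqP[s sE] := fg.
pose I : finType := seq_sub s.
pose x (i : I) : R := ssval i.
have xE (i : I) : exists y, g y = x i.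
  have : range g (x i) by rewrite sE /=; exact: ssvalP.
  by move=> [y _ gy]; exists y.
have mpre A : measurable A -> measurable (g @^-1` A).
  by move=> mA; rewrite -[X in measurable X]setTI; exact: mg.
have sumE (A : set R) : \sum_(i | x i \in A) prm (g @^-1` [set x i]) = prm (g @^-1` A).
  rewrite -big_filter -pr_bigcup_disj.
  - congr Pr; rewrite -bigcup_seq; apply/seteqP; split=> y /=.
      by move=> [i /=]; rewrite mem_filter => /andP[/set_mem iA _] ->.
    move=> gA; have : range g (g y) by exists y.
    rewrite sE => /= gI.
    exists (SeqSub gI) => //=; rewrite mem_filter mem_index_enum andbT.
    exact/mem_set.
  - by move=> i; apply: mpre; exact: measurable_set1.
  - by rewrite filter_uniq// index_enum_uniq.
  - by move=> i j y /= -> /val_inj.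
have [||||b [c [tau [X [[bm cm b0 c0] mt val crs [fin law]]]]]] :=
  @discrete_embedding _ _ _ _ _ hW I x (fun i => prm (g @^-1` [set x i])).
- exact: val_inj.
- by move=> i; have [y <-] := xE i.
- by move=> i; exact: pr_ge0.
- have := sumE setT; rewrite preimage_setT prT => <-.
  by apply: eq_bigl => i; rewrite in_setT.
exists (b, fun t => - c t, tau, X)%E; split=> //.
- split=> //; first by move=> r t rt; rewrite leeN2; exact: cm.
  by move=> t; rewrite oppe_ge0.
- move=> w r /val[r0 Xs [h|h]]; split=> //; [by left|right].
  by rewrite EFinN leeN2.
- move=> w r r0 [h|h]; apply: crs => //; [by left|right].
  by rewrite -lteN2 -EFinN.
- by split=> // A mA; rewrite law.
Qed.

Hypothesis mu0 : mu [set 0] = 0%E.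

(** The barriers of the simple images of [mu] are indexed by two copies of the
   rationals, one for each side, so that a single extraction serves for both. *)
Lemma general_embedding :
  exists (Lb Lc : rat -> \bar R) (X : {RV P >-> R}),
    [/\ (forall q, (0 <= Lb q)%E) /\ (forall q, (0 <= Lc q)%E),
        {ae P, forall w, first_time (touches W Lb Lc) w = first_time (crosses W Lb Lc) w},
        {ae P, forall w, (0 < first_time (touches W Lb Lc) w < +oo)%E},
        {ae P, forall w, W (fine (first_time (touches W Lb Lc) w)) w = X w} &
        forall A : set R, measurable A -> distribution P X A = mu A].
Proof.
have [pi_ [mpi fpi pi0 pic]] := nonzero_simple_approximation R.
have [z hz] := choice (fun n => simple_embedding (mpi n) (fpi n) (pi0 n)).
pose b n := (z n).1.1.1; pose c n := (z n).1.1.2.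
pose tau n := (z n).1.2; pose X n := (z n).2.
have {}hz n : _ := hz n.
have hz' n : [/\ [/\ {homo b n : s t / s <= t >-> (s <= t)%E},
            {homo c n : s t / s <= t >-> (s <= t)%E},
            forall t, (0 <= b n t)%E & forall t, (0 <= c n t)%E],
        [/\ measurable_fun setT (tau n), forall w, (0 <= tau n w)%E & measurable_fun setT (X n)],
        forall w s, tau n w = s%:E ->
          [/\ 0 < s, X n w = W s w & (b n s <= (X n w)%:E \/ c n s <= (- X n w)%:E)%E],
        forall w s, 0 < s -> (b n s < (W s w)%:E \/ c n s < (- W s w)%:E)%E ->
          (tau n w <= s%:E)%E &
        {ae P, forall w, (tau n w < +oo)%E} /\
        forall A : set R, measurable A -> prP (X n @^-1` A) = prm (pi_ n @^-1` A)].
  by have := hz n; rewrite /b /c /tau /X; case: (z n) => [[[? ?] ?] ?].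
clear hz.
pose u n (j : rat + rat) := match j with inl q => b n (ratr q) | inr q => c n (ratr q) end.
have [phi [L [phik Lup Ldown]]] := ereal_diagonal u.
pose Lb q := L (inl q); pose Lc q := L (inr q).
have Lb0 q : (0 <= Lb q)%E.
  rewrite leNgt; apply/negP => /Lup[N /(_ N (leqnn _))] /=.
  by have [[_ _ h _] _ _ _ _] := hz' (phi N); rewrite ltNge h.
have Lc0 q : (0 <= Lc q)%E.
  rewrite leNgt; apply/negP => /Lup[N /(_ N (leqnn _))] /=.
  by have [[_ _ _ h] _ _ _ _] := hz' (phi N); rewrite ltNge h.
have picphi y : pi_ (phi n) y @[n --> \oo] --> y.
  apply/cvgrPdist_lt => e e0; move/cvgrPdist_lt: (pic y) => /(_ _ e0)[N _ hN].
  by exists N => // n /= Nn; apply: hN => /=; exact: leq_trans (phik n).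
have h1 n : {homo b (phi n) : s t / s <= t >-> (s <= t)%E} by have [[]] := hz' (phi n).
have h2 n : {homo c (phi n) : s t / s <= t >-> (s <= t)%E} by have [[]] := hz' (phi n).
have h3 n : measurable_fun setT (tau (phi n)) by have [_ []] := hz' (phi n).
have h4 n : measurable_fun setT (X (phi n)) by have [_ []] := hz' (phi n).
have h5 n w : (0 <= tau (phi n) w)%E by have [_ []] := hz' (phi n).
have h6 n w s : tau (phi n) w = s%:E -> [/\ 0 < s, X (phi n) w = W s w &
    (b (phi n) s <= (X (phi n) w)%:E \/ c (phi n) s <= (- X (phi n) w)%:E)%E].
  by have [_ _ h _ _] := hz' (phi n); exact: h.
have h7 n w s : 0 < s -> (b (phi n) s < (W s w)%:E \/ c (phi n) s < (- W s w)%:E)%E ->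
    (tau (phi n) w <= s%:E)%E.
  by have [_ _ _ h _] := hz' (phi n); exact: h.
have h8 n : {ae P, forall w, (tau (phi n) w < +oo)%E} by have [_ _ _ _ []] := hz' (phi n).
have h9 n A : measurable A -> prP (X (phi n) @^-1` A) = prm (pi_ (phi n) @^-1` A).
  by have [_ _ _ _ [_ h]] := hz' (phi n); exact: h.
have tc := first_time_touch_cross hW Lb Lc.
have s0 := @sigma_gt0 _ _ _ _ _ hW _ mu0 (b \o phi) (c \o phi) (tau \o phi) (X \o phi)
  (pi_ \o phi) Lb Lc h3 h4 h5 h6 h7 h9 (fun n => mpi (phi n)) picphi
  (fun q => Lup (inl q)) (fun q => Lup (inr q)).
have sy := @sigma_lty _ _ _ _ _ hW _ mu0 (b \o phi) (c \o phi) (tau \o phi) (X \o phi)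
  (pi_ \o phi) Lb Lc h1 h2 h3 h4 h5 h6 h8 h9 (fun n => mpi (phi n)) picphi
  (fun q => Ldown (inl q)) (fun q => Ldown (inr q)).
have lle := @limit_law_le _ _ _ _ _ hW _ mu0 (b \o phi) (c \o phi) (tau \o phi) (X \o phi)
  (pi_ \o phi) Lb Lc h1 h2 h3 h4 h5 h6 h7 h8 h9 (fun n => mpi (phi n)) picphi
  (fun q => Lup (inl q)) (fun q => Ldown (inl q)) (fun q => Lup (inr q)) (fun q => Ldown (inr q)).
have mX := limit_value_measurable hW Lb Lc.
pose XR : {RV P >-> R} := HB.pack (limit_value W Lb Lc) (isMeasurableFun.Build _ _ _ _ (limit_value W Lb Lc) mX).
exists Lb, Lc, XR; split=> //.
- by apply: filterS3 tc s0 sy => w -> -> ->.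
- by apply: filterS tc => w ->.
- have mid : @measurable_fun _ _ (measurableTypeR R) R setT idfun by exact: measurable_id.
  pose idR : {RV mu >-> R} := HB.pack (idfun : measurableTypeR R -> R)
    (isMeasurableFun.Build _ _ (measurableTypeR R) R idfun mid).
  have lo (y : R) : Pr (distribution P XR) `]-oo, y[%classic <=
      Pr (distribution mu idR) `]-oo, y]%classic.
    apply: (lle `]-oo, y[%classic `]-oo, y]%classic).
    + exact: interval_open.
    + exact: interval_closed.
    + by move=> w; rewrite /= !in_itv/=; exact: ltW.
  have hi (y : R) : Pr (distribution P XR) `]y, +oo[%classic <=
      Pr (distribution mu idR) `[y, +oo[%classic.
    apply: (lle `]y, +oo[%classic `[y, +oo[%classic).
    + exact: interval_open.
    + exact: interval_closed.
    + by move=> w; rewrite /= !in_itv/= !andbT; exact: ltW.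
  by move=> A mA; exact: (eq_law_of_rays lo hi mA).
Qed.

End embedding.

(** * One-sided barriers and conclusion *)

Lemma eq_first_time (T : Type) (R : realType) (E F : R -> T -> Prop) w :
  (forall t, 0 < t -> E t w <-> F t w) -> first_time E w = first_time F w.
Proof.
move=> EF; congr ereal_inf; apply/seteqP; split=> _ [t [t0 h] <-]; exists t => //.
  by split => //; exact/EF.
by split => //; exact/EF.
Qed.

(** Every point of [O] has a rational interval of measure zero around it. *)
Lemma open_off_support (R : realType) (mu : probability (measurableTypeR R) R)
    (O : set R) : open O -> (forall x, O x -> ~ topological_support mu x) ->
  {ae mu, forall y : R, ~ O y}.
Proof.
move=> oO nS.
pose F (ab : rat * rat) (y : R) := mu `](ratr ab.1 : R), ratr ab.2[%classic = 0%E ->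
  ~ (y \in `](ratr ab.1 : R), ratr ab.2[).
have : {ae mu, forall y, forall ab, F ab y}.
  apply: ae_forall_countable => -[a b]; rewrite /F/=.
  have [m0|m0] := pselect (mu `](ratr a : R), ratr b[%classic = 0%E); last exact: aeW.
  exists `](ratr a : R), ratr b[%classic; split => // y /= /not_implyP[_ /contrapT].
  by [].
move=> [N [mN N0 hN]]; exists N; split => // y /= nO; apply: hN => /= hy; apply: nO => Oy.
have := nS y Oy => /existsNP[U] /not_implyP[oU].
move=> /not_implyP[Uy /negP]; rewrite -leNgt measure_le0 => /eqP U0.
have /nbhs_ballP[e /= e0 he] : nbhs y U by exact: open_nbhs_nbhs.
have ye : y - e < y by lra.
have ey : y < y + e by lra.
have [a] := rat_in_itvoo ye; rewrite in_itv/= => /andP[a1 a2].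
have [b] := rat_in_itvoo ey; rewrite in_itv/= => /andP[b1 b2].
apply: (hy (a, b)); last by rewrite /= in_itv/= a2 b1.
apply/eqP; rewrite -measure_le0 -U0; apply: le_measure; rewrite ?inE//=.
  exact: open_measurable.
move=> z /=; rewrite in_itv/= => /andP[z1 z2]; apply: he => /=.
by rewrite /ball/= ltr_distl; lra.
Qed.

Section one_sided.
Context d (T : measurableType d) (R : realType) (P : probability T R).
Context (W : R -> T -> R) (hW : continuous_bm P W) (Lb Lc : rat -> \bar R).
Local Notation b := (lim_barrier (R := R) Lb).
Local Notation tau := (first_time (touches W Lb Lc)).
Hypothesis Lc0 : forall q, (0 <= Lc q)%E.
Hypothesis tc : {ae P, forall w, tau w = first_time (crosses W Lb Lc) w}.
Hypothesis tau_pos : {ae P, forall w, (0 < tau w < +oo)%E}.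
Hypothesis W_pos : {ae P, forall w, 0 < W (fine (tau w)) w}.

(** The stopped value is positive, so that crossings just after the stopping time
   are crossings of the upper barrier. *)
Let upper_hit : {ae P, forall w, exists2 s, 0 < s &
  [/\ tau w = s%:E, (b s <= (W s w)%:E)%E & forall u, 0 < u < s -> ((W u w)%:E <= b u)%E]}.
Proof.
apply: filterS3 tc tau_pos W_pos => w st; case es: (tau w) => [s| |]/= s0 Ws; last 2 first.
- by move: s0; rewrite ltxx andbF.
- by [].
rewrite lte_fin ltry andbT in s0; rewrite es in st; exists s => //; split => //; last first.
  move=> u /andP[u0 us]; rewrite leNgt; apply/negP => h.
  have : (first_time (crosses W Lb Lc) w <= u%:E)%E.
    by apply: ereal_inf_lbound; exists u => //; split => //; left.
  by rewrite -st lee_fin leNgt us.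
rewrite leNgt; apply/negP => hb.
have [y Wy yb] : exists2 y, W s w < y & (y%:E <= b s)%E.
  case: (b s) hb => [l| |//]; last by move=> _; exists (W s w + 1); [lra|rewrite leey].
  by rewrite lte_fin => h; exists l.
have e0 : 0 < Num.min (W s w) (y - W s w) by rewrite lt_min Ws subr_gt0.
have [r r0 hr] := cbm_near hW w s e0.
have : (first_time (crosses W Lb Lc) w < (s + r)%:E)%E by rewrite -st lte_fin; lra.
move=> /ereal_inf_lt[_ [t [t0 ht] <-]]; rewrite lte_fin => tr.
have st' : s <= t.
  by rewrite -lee_fin st; apply: ereal_inf_lbound; exists t.
have /hr : `|t - s| < r by rewrite ltr_distl; lra.
rewrite lt_min !ltr_distl => /andP[/andP[h1 h2] /andP[h3 h4]].
case: ht => ht.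
  have := le_lt_trans (lim_barrier_homo Lb st') ht => /(le_lt_trans yb).
  by rewrite lte_fin; lra.
have := le_lt_trans (lim_barrier_ge0 Lc0 t0) ht; rewrite lte_fin; lra.
Qed.

Lemma one_sided_first_time :
  {ae P, forall w, first_time (fun t w => (b t <= (W t w)%:E)%E) w = tau w}.
Proof.
apply: filterS upper_hit => w [s s0 [es bs _]]; apply/eqP; rewrite eq_le; apply/andP; split.
  by rewrite es; apply: ereal_inf_lbound; exists s.
by apply: ereal_inf_le_tmp => _ [t [t0 ht] <-]; exists t => //; split => //; left.
Qed.

(** A barrier that becomes infinite at a finite time is missed with positive
   probability, whereas almost every path hits this one. *)
Lemma one_sided_finite t : 0 < t -> (b t < +oo)%E.
Proof.
move=> t0; rewrite ltey; apply/eqP => bt.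
have bi : increasing_on_pos b by move=> s u _; exact: lim_barrier_homo.
apply: (@stay_below_barrier _ _ _ _ _ hW b (t + 1) bi); first lra.
  by apply: filterS upper_hit => w [s s0 [_ _ h]]; exists s.
apply: filterS2 upper_hit (touch_then_cross hW bi) => w [s s0 [_ bs _]] h.
have st : s <= t.
  rewrite leNgt; apply/negP => /ltW/(lim_barrier_homo Lb); rewrite bt.
  by move=> /le_trans/(_ bs); rewrite leye_eq.
have [|u /andP[u0 ut] hu] := h s s0 bs (t + 1); first lra.
by exists u => //; rewrite u0 ltW.
Qed.

End one_sided.

Theorem theorem1 (d : measure_display) (T : measurableType d) (R : realType)
    (P : probability T R) (B : R -> {RV P >-> R})
    (hB : standard_brownian_motion B)
    (mu : probability (measurableTypeR R) R) (hmu0 : mu [set 0] = 0%E) :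
  (topological_support mu `<=` `[0, +oo[ ->
    exists b : R -> R,
      [/\ left_continuous_on_pos b, increasing_on_pos b &
          stopped_law P B (first_time (fun t w => b t <= B t w)) mu]) /\
  (topological_support mu `<=` `]-oo, 0] ->
    exists c : R -> R,
      [/\ left_continuous_on_pos c, decreasing_on_pos c &
          stopped_law P B (first_time (fun t w => B t w <= c t)) mu]) /\
  (topological_support mu `&` `[0, +oo[ !=set0 ->
   topological_support mu `&` `]-oo, 0] !=set0 ->
    exists (b c : R -> \bar R),
      [/\ (forall t, 0 < t -> b t != -oo%E),
          (forall t, 0 < t -> c t != +oo%E),
          left_continuous_on_pos b /\ increasing_on_pos b,
          left_continuous_on_pos c /\ decreasing_on_pos c &
          stopped_law P B (first_time (fun t w =>
            (b t <= (B t w)%:E)%E \/ ((B t w)%:E <= c t)%E)) mu]).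
Proof.
have [W hW WB] := continuous_bm_of_standard hB.
have [Lb [Lc [X [[Lb0 Lc0] tc tau_pos WX law]]]] := general_embedding hW hmu0.
pose b : R -> \bar R := lim_barrier Lb; pose c : R -> \bar R := lim_barrier Lc.
set tau := first_time (touches W Lb Lc) in tc tau_pos WX.
have fine_tau w : (0 < tau w < +oo)%E -> 0 <= fine (tau w).
  by move=> /andP[/ltW h _]; exact: fine_ge0.
have lawP (tau' : T -> \bar R) : {ae P, forall w, tau' w = tau w} -> stopped_law P B tau' mu.
  move=> et; split.
    by apply: filterS2 et tau_pos => w -> /andP[].
  exists X; split => //.
  have : {ae P, forall w, 0 <= fine (tau w)} by apply: filterS tau_pos => w; exact: fine_tau.
  move=> tau0; have WXB : {ae P, forall w, B (fine (tau w)) w = X w}.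
    by apply: filterS3 WB WX tau0 => w WBw <- /WBw.
  by apply: filterS2 et WXB => w ->.
have X_off (O : set R) : open O -> (forall x, O x -> ~ topological_support mu x) ->
    {ae P, forall w, ~ O (X w)}.
  move=> oO nS; have mO : measurable O by exact: open_measurable.
  have mXO : measurable (X @^-1` O) by rewrite -[Y in measurable Y]setTI; exact: measurable_funP.
  have h0 : Pr mu O = 0 by apply/ae_pr0P => //; exact: open_off_support.
  have : Pr P (X @^-1` O) = 0.
    by rewrite -h0 /Pr -(law O mO).
  by move/(ae_pr0P _ mXO); apply: filterS.
have X0 : {ae P, forall w, X w <> 0}.
  have m0 : measurable [set 0 : R] by exact: measurable_set1.
  have mX0 : measurable (X @^-1` [set 0]) by rewrite -[Y in measurable Y]setTI; exact: measurable_funP.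
  have : Pr P (X @^-1` [set 0]) = 0.
    by have := law _ m0; rewrite hmu0 /Pr /distribution /pushforward => ->.
  by move/(ae_pr0P _ mX0); apply: filterS.
split; [|split].
- move=> supp.
  have Xpos : {ae P, forall w, 0 < W (fine (tau w)) w}.
    have H : {ae P, forall w, ~ `]-oo, 0[%classic (X w)}.
      apply: X_off; first exact: interval_open.
      by move=> x; rewrite /= in_itv/= => x0 /supp; rewrite /= in_itv/= andbT leNgt x0.
    apply: filterS3 WX X0 H => w -> /eqP X0w.
    by rewrite /= in_itv/= => /negP; rewrite -leNgt lt_neqAle eq_sym X0w.
  have fin t (t0 : 0 < t) : b t \is a fin_num.
    rewrite ge0_fin_numE; last exact: lim_barrier_ge0.
    exact: (one_sided_finite hW Lc0 tc tau_pos Xpos).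
  exists (fun t => fine (b t)); split.
  + move=> t t0; apply: fine_cvg; rewrite fineK ?fin//.
    exact: lim_barrier_left_continuous.
  + move=> s t s0 st; apply: fine_le; rewrite ?fin//; first exact: lt_le_trans st.
    exact: lim_barrier_homo.
  + apply: lawP; apply: filterS2 WB (one_sided_first_time hW Lc0 tc tau_pos Xpos) => w WBw e1.
    rewrite /tau -e1; apply: eq_first_time => t t0.
    by rewrite -lee_fin fineK ?fin// WBw// ltW.
- move=> supp; pose V t w := - W t w; have hV := continuous_bm_opp hW.
  have eT w : first_time (touches V Lc Lb) w = tau w.
    by apply: eq_first_time => t _; rewrite /touches /V opprK; tauto.
  have eC w : first_time (crosses V Lc Lb) w = first_time (crosses W Lb Lc) w.
    by apply: eq_first_time => t _; rewrite /crosses /V opprK; tauto.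
  have tcV : {ae P, forall w,
      first_time (touches V Lc Lb) w = first_time (crosses V Lc Lb) w}.
    by apply: filterS tc => w; rewrite eT eC.
  have posV : {ae P, forall w, (0 < first_time (touches V Lc Lb) w < +oo)%E}.
    by apply: filterS tau_pos => w; rewrite eT.
  have Vpos : {ae P, forall w, 0 < V (fine (first_time (touches V Lc Lb) w)) w}.
    have H : {ae P, forall w, ~ `]0, +oo[%classic (X w)}.
      apply: X_off; first exact: interval_open.
      by move=> x; rewrite /= in_itv/= andbT => x0 /supp; rewrite /= in_itv/= leNgt x0.
    apply: filterS3 WX X0 H => w e1 /eqP X0w; rewrite eT /V e1 oppr_gt0.
    by rewrite /= in_itv/= andbT => /negP; rewrite -leNgt lt_neqAle X0w.
  have fin t (t0 : 0 < t) : c t \is a fin_num.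
    rewrite ge0_fin_numE; last exact: lim_barrier_ge0.
    exact: (one_sided_finite hV Lb0 tcV posV Vpos).
  exists (fun t => - fine (c t)); split.
  + move=> t t0; apply: cvgN; apply: fine_cvg; rewrite fineK ?fin//.
    exact: lim_barrier_left_continuous.
  + move=> s t s0 st; rewrite lerN2; apply: fine_le; rewrite ?fin//.
      exact: lt_le_trans st.
    exact: lim_barrier_homo.
  + apply: lawP; apply: filterS2 WB (one_sided_first_time hV Lb0 tcV posV Vpos) => w WBw e1.
    rewrite -eT -e1; apply: eq_first_time => t t0.
    by rewrite lerNr -lee_fin fineK ?fin// /V WBw// ltW.
- move=> _ _; exists b, (fun t => - c t)%E; split.
  + by move=> t t0; rewrite gt_eqF// (lt_le_trans _ (lim_barrier_ge0 Lb0 t0)).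
  + move=> t t0; rewrite lt_eqF//; apply: (@le_lt_trans _ _ 0%E) => //.
    by rewrite oppe_le0; exact: lim_barrier_ge0.
  + split; first exact: lim_barrier_left_continuous.
    by move=> s t _; exact: lim_barrier_homo.
  + split; first by move=> t t0; apply: cvgeN; exact: lim_barrier_left_continuous.
    by move=> s t _ st; rewrite leeN2; exact: lim_barrier_homo.
  + apply: lawP; apply: filterS WB => w WBw; apply: eq_first_time => t t0.
    by rewrite /touches WBw; [rewrite -/(c t) EFinN leeNr|exact: ltW].
Qed.
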